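(* Let $(X,\mathscr B,\mu)$ be a probability space and let $P:L^1(\mu)\to L^1(\mu)$ be a Markov operator with $P1_X=1_X$. Let $(\phi_n)_{n\ge1}$ be a $P$-subadditive sequence of extended real-valued measurable functions such that $\phi_1^+\in L^1(\mu)$. Then there exists a measurable $P$-invariant function $g$ (i.e. $Pg=g$) such that $g^+\in L^1(\mu)$, $$\lim_{n\to\infty}\frac1n\phi_n(x)=g(x)\ \text{ for }\mu\text{-a.e. }x\in X,\qquad\text{and}\qquad \int g\,d\mu=\lim_{n\to\infty}\frac1n\int\phi_n\,d\mu=:\Lambda(\mu).$$ Moreover, if $\mu$ is ergodic, then $g=\Lambda(\mu)$ $\mu$-almost everywhere.
   Context: Here a Markov operator on $L^1(\mu)$ is a linear, positive operator with $\int P\varphi\,d\mu=\int\varphi\,d\mu$ for all $\varphi\in L^1(\mu)$. It extends by monotone limits to measurable functions $\varphi$ with values in $[-\infty,\infty]$ and $\varphi^+=\max\{\varphi,0\}\in L^1(\mu)$. The sequence $(\phi_n)$ is $P$-subadditive if $\phi_{n+m}\le\phi_n+P^n\phi_m$ ($\mu$-a.e.) for all $n,m\ge1$. Functions are identified when equal $\mu$-a.e.; $g$ and $\Lambda(\mu)$ may take the value $-\infty$. The measure $\mu$ is ergodic (for $P$) if every measurable set $A$ with $P1_A=1_A$ $\mu$-a.e. has $\mu(A)\in\{0,1\}$. *)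

(* Defs.v *)
From HB Require Import structures.
From mathcomp Require Import all_boot all_order all_algebra.
From mathcomp Require Import all_classical all_reals all_analysis.
From mathcomp Require Import measurable_realfun.

Set Implicit Arguments.
Unset Strict Implicit.
Unset Printing Implicit Defensive.
Import Order.TTheory GRing.Theory Num.Theory.
Import numFieldNormedType.Exports.

Local Open Scope classical_set_scope.
Local Open Scope ring_scope.

(* [P] acts on representatives: only its values on integrable functions matter,
   and every condition is stated up to mu-a.e. equality, so that [P] is an
   operator on the classes of L^1(mu). *)
Record markov_operator d (X : measurableType d) (R : realType)
    (mu : probability X R) (P : (X -> R) -> X -> R) : Prop := MarkovOperator {
  markov_Lfun : forall f, f \in Lfun mu 1%E -> P f \in Lfun mu 1%E ;
  markov_ae_eq : forall f g, f \in Lfun mu 1%E -> g \in Lfun mu 1%E ->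
    f = g %[ae mu] -> P f = P g %[ae mu] ;
  markov_linear : forall (a : R) f g,
    f \in Lfun mu 1%E -> g \in Lfun mu 1%E ->
    P (a *: f + g) = a *: P f + P g %[ae mu] ;
  markov_ge0 : forall f, f \in Lfun mu 1%E ->
    (\forall x \ae mu, 0 <= f x) -> \forall x \ae mu, 0 <= P f x ;
  markov_integral : forall f, f \in Lfun mu 1%E ->
    (\int[mu]_x (P f x)%:E = \int[mu]_x (f x)%:E)%E
}.

(* The function max(phi, -k). When phi^+ is integrable it takes the value +oo,
   which [fine] sends to 0, only on a mu-null set. *)
Definition truncate_below (X : Type) (R : realType)
    (phi : X -> \bar R) (k : nat) : X -> R :=
  fun x => fine (maxe (phi x) (- k%:R)%:E).

(* The extension of [P] to functions phi with phi^+ integrable, as the limit of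
   P (max (phi, -k)) as k tends to infinity. That sequence is nonincreasing
   mu-a.e., hence convergent mu-a.e.; [limn_esup] is its limit wherever it
   converges, and yields a representative that is measurable everywhere. *)
Definition markov_ext (X : Type) (R : realType)
    (P : (X -> R) -> X -> R) (phi : X -> \bar R) : X -> \bar R :=
  fun x => limn_esup (fun k => (P (truncate_below phi k) x)%:E).

(* The value at index 0 is irrelevant: sequences are indexed by n >= 1. *)
Definition subadditive_for d (X : measurableType d) (R : realType)
    (mu : probability X R) (P : (X -> R) -> X -> R)
    (phi : nat -> X -> \bar R) : Prop :=
  forall n m, (0 < n)%N -> (0 < m)%N ->
    \forall x \ae mu,
      (phi (n + m)%N x <= phi n x + iter n (markov_ext P) (phi m) x)%E.

Definition ergodic_for d (X : measurableType d) (R : realType)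
    (mu : probability X R) (P : (X -> R) -> X -> R) : Prop :=
  forall A : set X, measurable A -> P \1_A = \1_A %[ae mu] ->
    mu A = 0%E \/ mu A = 1%E.

Definition mean_integral d (X : measurableType d) (R : realType)
    (mu : probability X R) (phi : nat -> X -> \bar R) (n : nat) : \bar R :=
  ((n%:R^-1)%:E * \int[mu]_x phi n x)%E.

(* The number Lambda(mu), possibly -oo. *)
Definition asymptotic_mean d (X : measurableType d) (R : realType)
    (mu : probability X R) (phi : nat -> X -> \bar R) : \bar R :=
  limn (mean_integral mu phi).

(* Main.v *)
(** The heart of the proof is a maximal inequality which survives the absence of
    an underlying map.  Let psi_n >= 0 be superadditive for P, let v >= 0 satisfy
    P v <= v, and let A be the set where psi_n >= n v for some 1 <= n <= M.
    Superadditivity gives psi_N >= psi_n + P^n psi_(N-n) with n allowed to depend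
    on the point; taking such an n on A and n = 1 elsewhere, induction on N yields
    psi_N >= sum_(j < N-M) P^j (1_A v), hence int_A v <= sup_n (1/n) int psi_n.

    With v invariant this gives the pointwise ergodic theorem for bounded
    functions; with v constant it is a weak-type inequality.  For a nonnegative
    subadditive f_n, choose m with (1/m) int f_m close to inf_n (1/n) int f_n and
    split f_m = b + r with b bounded and int r small.  Then
    f_(km) = S_k b + S_k r - psi_k, where S_k is the Birkhoff sum of P^m and
    psi_k = S_k f_m - f_(km) >= 0 is superadditive with small mean, so f_n / n
    oscillates little outside a small set.  The general case follows by applying
    this to max (phi_n, - K n) + K n and letting K tend to infinity. *)

Require Import Defs.
From HB Require Import structures.
From mathcomp Require Import all_boot all_order all_algebra.
From mathcomp Require Import all_classical all_reals all_analysis.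
From mathcomp Require Import measurable_realfun.
From mathcomp Require Import zify ring lra.

Set Implicit Arguments.
Unset Strict Implicit.
Unset Printing Implicit Defensive.
Import Order.TTheory GRing.Theory Num.Theory.
Import numFieldNormedType.Exports.

Local Open Scope classical_set_scope.
Local Open Scope ring_scope.

(** * Integrable real functions *)

(** Positivity of [P] yields one-sided inequalities only. Identities such as [P w = w] come from
    pairing such an inequality with equality of integrals, since [P] preserves integrals and an
    integrable nonnegative function of integral at most 0 vanishes. Fatou's lemma favours lower
    limits of nonnegative functions, so invariance is first obtained for lower limits of
    superadditive sequences. Upper bounds and subadditive sequences are reached by subtraction:
    [C - b] for a bounded function, a Birkhoff sum minus [f] for a subadditive sequence.

    Returning from multiples of m to all indices costs remainders of the form P^n h with h
    integrable. That P^n h / n tends to 0 almost everywhere is again a consequence of the weak-type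
    inequality. Its exceptional sets depend on the accuracy, and are removed by letting their
    measure tend to 0.

    The floor in the final truncation is linear in the index because subadditivity must survive it:
    the floors at n and m have to add up to the floor at n + m. *)

Lemma le_natr_bound (R : archiRealFieldType) (x : R) (k : nat) :
  (Num.bound `|x| <= k)%N -> x <= k%:R.
Proof.
move=> xk; rewrite (le_trans (ler_norm _))// ltW//.
by rewrite (lt_le_trans (archi_boundP _))// ler_nat.
Qed.

Lemma ge_Nnatr_bound (R : archiRealFieldType) (x : R) (k : nat) :
  (Num.bound `|x| <= k)%N -> - k%:R <= x.
Proof. by move=> xk; rewrite lerNl le_natr_bound// normrN. Qed.

Lemma measurable_le_set d (X : measurableType d) (R : realType) (f g : X -> R) :
  measurable_fun setT f -> measurable_fun setT g -> measurable [set x | f x <= g x].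
Proof.
move=> mf mg; have /(_ measurableT [set true]) := measurable_fun_ler mf mg.
rewrite setTI (_ : _ @^-1` _ = [set x | f x <= g x]); first exact.
by apply/seteqP; split=> x /=.
Qed.

Lemma einfs_le_limn_einf (R : realType) (u : nat -> \bar R) n :
  (einfs u n <= limn_einf u)%E.
Proof.
rewrite limn_einf_lim (cvg_lim _ (@cvg_einfs_sup _ u))//.
by apply: ereal_sup_ubound; exists n.
Qed.

Lemma measurable_lt_set d (X : measurableType d) (R : realType) (f g : X -> R) :
  measurable_fun setT f -> measurable_fun setT g -> measurable [set x | f x < g x].
Proof.
move=> mf mg; rewrite (_ : [set _ | _] = ~` [set x | g x <= f x]).
  by apply: measurableC; exact: measurable_le_set.
by apply/seteqP; split=> x /=; rewrite ltNge => /negP.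
Qed.

Lemma measurable_exists_le d (X : measurableType d) (R : realType) (D : set nat)
    (v : X -> R) (psi : nat -> X -> R) :
  measurable_fun setT v -> (forall n, measurable_fun setT (psi n)) ->
  measurable [set x | exists2 n, D n & n%:R * v x <= psi n x].
Proof.
move=> mv mpsi.
rewrite (_ : [set _ | _] = \bigcup_(n in D) [set x | n%:R * v x <= psi n x]).
  apply: bigcup_measurable => n _; apply: measurable_le_set => //.
  exact: measurable_funM.
by apply/seteqP; split=> x [n ? ?]; exists n.
Qed.

Section L1.
Context d (X : measurableType d) (R : realType) (mu : probability X R).
Implicit Types (f g h : X -> R).

Local Notation L1 := (Lfun mu 1%E).

Lemma L1_measurable f : f \in L1 -> measurable_fun setT f.
Proof. by move=> /Lfun1_integrable/measurable_int/measurable_EFinP. Qed.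

Lemma L1_cst (c : R) : cst c \in L1.
Proof. exact: Lfun_cst. Qed.

Lemma L1_le f g : measurable_fun setT f -> g \in L1 ->
  (\forall x \ae mu, `|f x| <= g x) -> f \in L1.
Proof.
move=> mf /Lfun1_integrable /integrableP[mg gy] fg.
apply/Lfun1_integrable/integrableP; split; first exact/measurable_EFinP.
apply: le_lt_trans gy; apply: ae_ge0_le_integral => //.
- by apply/measurable_EFinP; exact: measurableT_comp.
- by apply/measurable_EFinP; apply: measurableT_comp => //; exact/measurable_EFinP.
- apply: filterS fg => x fg _; rewrite lee_fin (le_trans fg)//.
  exact: ler_norm.
Qed.

Lemma L1D f g : f \in L1 -> g \in L1 -> f + g \in L1.
Proof. by move=> Lf Lg; rewrite rpredD. Qed.

Lemma L1B f g : f \in L1 -> g \in L1 -> f - g \in L1.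
Proof. by move=> Lf Lg; rewrite rpredB. Qed.

Lemma L1Z (c : R) f : f \in L1 -> c *: f \in L1.
Proof. by move=> Lf; rewrite rpredZ. Qed.

Lemma L1_max f g : f \in L1 -> g \in L1 -> f \max g \in L1.
Proof.
move=> Lf Lg; apply: (@L1_le _ ((Num.norm \o f) + (Num.norm \o g))).
- by apply: measurable_maxr; exact: L1_measurable.
- by rewrite rpredD//; exact: Lfun_norm.
- apply: aeW => x /=; rewrite fctE /= maxEle.
  by case: ifP => _; rewrite ?lerDl ?lerDr normr_ge0.
Qed.

Lemma L1_min f g : f \in L1 -> g \in L1 -> f \min g \in L1.
Proof.
move=> Lf Lg; apply: (@L1_le _ ((Num.norm \o f) + (Num.norm \o g))).
- by apply: measurable_minr; exact: L1_measurable.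
- by rewrite rpredD//; exact: Lfun_norm.
- apply: aeW => x /=; rewrite fctE /= minEle.
  by case: ifP => _; rewrite ?lerDl ?lerDr normr_ge0.
Qed.

Lemma L1_indicM f (A : set X) : measurable A -> f \in L1 -> f * \1_A \in L1.
Proof.
move=> mA Lf; apply: (@L1_le _ (Num.norm \o f)).
- by apply: measurable_funM; [exact: L1_measurable|exact: measurable_indic].
- exact: Lfun_norm.
- apply: aeW => x /=; rewrite fctE normrM ler_piMr//.
  by rewrite indicE; case: (_ \in _); rewrite /= ?normr1 ?normr0.
Qed.

Lemma L1_indic (A : set X) : measurable A -> (\1_A : X -> R) \in L1.
Proof. by move=> mA; apply/Lfun1_integrable/integrable_indic. Qed.

Local Notation Int f := (Rintegral mu setT f).

Lemma IntE f : f \in L1 -> (\int[mu]_x (f x)%:E)%E = (Int f)%:E.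
Proof. by move=> /Lfun1_integrable Lf; rewrite fineK// integrable_fin_num. Qed.

Lemma IntD f g : f \in L1 -> g \in L1 -> Int (f + g) = Int f + Int g.
Proof. by move=> /Lfun1_integrable Lf /Lfun1_integrable Lg; rewrite -RintegralD. Qed.

Lemma IntZ (c : R) f : f \in L1 -> Int (c *: f) = c * Int f.
Proof. by move=> /Lfun1_integrable Lf; rewrite -RintegralZl. Qed.

Lemma IntB f g : f \in L1 -> g \in L1 -> Int (f - g) = Int f - Int g.
Proof. by move=> /Lfun1_integrable Lf /Lfun1_integrable Lg; rewrite -RintegralB. Qed.

Lemma Int_cst (c : R) : Int (cst c) = c.
Proof. by rewrite Rintegral_cst//= [mu setT]probability_setT mulr1. Qed.

Lemma L1_sum (F : nat -> X -> R) n : (forall i, F i \in L1) ->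
  \sum_(i < n) F i \in L1.
Proof. by move=> LF; rewrite rpred_sum. Qed.

Lemma Int_sum (F : nat -> X -> R) n : (forall i, F i \in L1) ->
  Int (\sum_(i < n) F i) = \sum_(i < n) Int (F i).
Proof.
move=> LF; elim: n => [|n IH]; first by rewrite !big_ord0 (Int_cst 0).
by rewrite !big_ord_recr/= IntD ?IH//; exact: L1_sum.
Qed.

Lemma Int_ae_eq f g : f \in L1 -> g \in L1 ->
  (\forall x \ae mu, f x = g x) -> Int f = Int g.
Proof.
move=> Lf Lg fg; rewrite /Rintegral; congr fine; apply: ae_eq_integral => //.
- by apply/measurable_EFinP; exact: L1_measurable.
- by apply/measurable_EFinP; exact: L1_measurable.
- by apply: filterS fg => x -> _.
Qed.

Lemma Int_ge0 f : f \in L1 -> (\forall x \ae mu, 0 <= f x) -> 0 <= Int f.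
Proof.
move=> Lf f0; rewrite (@Int_ae_eq _ (Num.norm \o f))//.
- by apply: Rintegral_ge0 => x _ /=.
- exact: Lfun_norm.
- by apply: filterS f0 => x f0; rewrite /= ger0_norm.
Qed.

Lemma le_Int f g : f \in L1 -> g \in L1 ->
  (\forall x \ae mu, f x <= g x) -> Int f <= Int g.
Proof.
move=> Lf Lg fg; rewrite -subr_ge0 -IntB//; apply: Int_ge0.
- exact: rpredB.
- by apply: filterS fg => x; rewrite !fctE subr_ge0.
Qed.

Lemma Int_le0 f : f \in L1 -> (\forall x \ae mu, 0 <= f x) -> Int f <= 0 ->
  \forall x \ae mu, f x = 0.
Proof.
move=> Lf f0 If0; have {}If0 : Int (Num.norm \o f) = 0.
  have If := @Int_ae_eq f (Num.norm \o f) Lf (Lfun_norm Lf).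
  rewrite -If; first by apply/le_anti/andP; split=> //; apply: Int_ge0.
  by apply: filterS f0 => x f0; rewrite /= ger0_norm.
have mf : measurable_fun setT (EFin \o f).
  by apply/measurable_EFinP; exact: L1_measurable.
have /(ae_eq_integral_abs mu measurableT mf) : (\int[mu]_x `|(EFin \o f) x| = 0)%E.
  by rewrite (@IntE (Num.norm \o f)) ?If0//; exact: Lfun_norm.
by apply: filterS => x /(_ I) /= [].
Qed.

Lemma le_Int_ae_eq f g : f \in L1 -> g \in L1 ->
  (\forall x \ae mu, f x <= g x) -> Int g <= Int f -> \forall x \ae mu, f x = g x.
Proof.
move=> Lf Lg fg Igf.
have : \forall x \ae mu, (g - f) x = 0.
  apply: Int_le0; first exact: rpredB.
    by apply: filterS fg => x; rewrite !fctE subr_ge0.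
  by rewrite IntB// subr_le0.
by apply: filterS => x; rewrite !fctE => /eqP; rewrite subr_eq0 => /eqP.
Qed.

Lemma dominated_cvg_Int (F : nat -> X -> R) f h :
  (forall n, measurable_fun setT (F n)) -> measurable_fun setT f -> h \in L1 ->
  (forall n, \forall x \ae mu, `|F n x| <= h x) ->
  (\forall x \ae mu, F n x @[n --> \oo] --> f x) ->
  f \in L1 /\ Int (F n) @[n --> \oo] --> Int f.
Proof.
move=> mF mf Lh Fh Ff.
have LF n : F n \in L1 by exact: L1_le (Fh n).
have [] := @dominated_convergence _ _ _ mu setT measurableT
  (fun n x => (F n x)%:E) (EFin \o f) (EFin \o h).
- by move=> n; exact/measurable_EFinP.
- exact/measurable_EFinP.
- by apply: filterS Ff => x Ff _; apply/cvg_EFin => //; exact: nearW.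
- exact/Lfun1_integrable.
- apply: ae_foralln => n; apply: filterS (Fh n) => x Fh' _.
  by rewrite lee_fin.
move=> /Lfun1_integrable Lf _ Fc; split=> //.
have {}Fc : (Int (F n))%:E @[n --> \oo] --> (Int f)%:E.
  by move: Fc; rewrite /= (IntE Lf); under eq_fun do rewrite IntE//.
exact: (fine_cvg Fc).
Qed.

Lemma fatou_Int (F : nat -> X -> R) (c : nat -> R) (l : R) :
  (forall n, F n \in L1) -> (forall n, \forall x \ae mu, 0 <= F n x) ->
  (forall n, Int (F n) <= c n) -> c n @[n --> \oo] --> l ->
  exists w, [/\ w \in L1, \forall x \ae mu, 0 <= w x, Int w <= l &
    \forall x \ae mu, (w x)%:E = limn_einf (fun n => (F n x)%:E)].
Proof.
move=> LF F0 Fc cl.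
(* With absolute values the functions are nonnegative everywhere, as [fatou] is applied; by [F0]
   they change nothing almost everywhere. *)
pose e x := limn_einf (fun n => (`|F n x|)%:E).
have mF n : measurable_fun setT (fun x => (`|F n x|)%:E).
  apply/measurable_EFinP/measurableT_comp => //; exact: L1_measurable.
have me : measurable_fun setT e.
  rewrite /e /limn_einf; apply: measurableT_comp => //.
  by apply: measurable_fun_limn_esup => n; exact: measurableT_comp.
have e0 x : (0 <= e x)%E.
  rewrite /e limn_einf_lim; apply: lime_ge; first exact: is_cvg_einfs.
  by apply: nearW => n; apply: le_ereal_inf_tmp => _ [m _ <-]; rewrite lee_fin.
have el : (\int[mu]_x e x <= l%:E)%E.
  apply: (le_trans (fatou mu measurableT mF _)); first by move=> *; rewrite lee_fin.
  rewrite limn_einf_lim; apply: (@le_trans _ _ (limn (EFin \o c))); last first.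
    rewrite (cvg_lim _ (_ : (EFin \o c) n @[n --> \oo] --> l%:E))//.
    by apply/cvg_EFin => //; exact: nearW.
  apply: lee_lim; first exact: is_cvg_einfs.
    by apply/cvg_ex; exists l%:E; apply/cvg_EFin => //; exact: nearW.
  apply: nearW => n; apply: (@le_trans _ _ (\int[mu]_x (`|F n x|)%:E)%E).
    by apply: ereal_inf_lbound; exists n => //=.
  rewrite (@IntE (Num.norm \o F n)) ?lee_fin; last exact: Lfun_norm.
  apply: le_trans (Fc n); apply: le_Int => //; first exact: Lfun_norm.
  by apply: filterS (F0 n) => x /= /ger0_norm ->.
have ie : mu.-integrable setT e.
  apply/integrableP; split=> //; under eq_integral do rewrite gee0_abs//.
  exact: le_lt_trans el (ltry _).
have ew : \forall x \ae mu, e x = (fine (e x))%:E.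
  by apply: filterS (integrable_ae measurableT ie) => x /(_ I)/fineK ->.
have mw : measurable_fun setT (fine \o e).
  by apply: measurableT_comp => //; exact: fine_measurable.
have Iw : (\int[mu]_x (fine (e x))%:E = \int[mu]_x e x)%E.
  apply: ae_eq_integral => //; first exact/measurable_EFinP.
  by apply: filterS ew => x <-.
have Lw : fine \o e \in L1.
  apply/Lfun1_integrable/integrableP; split; first exact/measurable_EFinP.
  under eq_integral do rewrite gee0_abs ?lee_fin ?fine_ge0//.
  by rewrite Iw; exact: le_lt_trans el (ltry _).
exists (fine \o e); split => //.
- by apply: aeW => x; exact: fine_ge0.
- by rewrite -lee_fin -IntE//= Iw.
- apply: filterS2 ew (ae_foralln F0) => x /= <- Fx; rewrite /e.
  by congr limn_einf; apply/funext => n; rewrite ger0_norm.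
Qed.

End L1.

(** * Markov operators *)

Lemma ae_cvg_measurable d (X : measurableType d) (R : realType)
    (mu : probability X R) (F : nat -> X -> R) :
  (forall n, measurable_fun setT (F n)) ->
  (\forall x \ae mu, cvgn (F ^~ x)) ->
  exists2 f : X -> R, measurable_fun setT f & \forall x \ae mu, F n x @[n --> \oo] --> f x.
Proof.
move=> mF cF; exists (fun x => fine (limn_esup (fun n => (F n x)%:E))).
  apply: measurableT_comp; first exact: fine_measurable.
  by apply: measurable_fun_limn_esup => n; exact/measurable_EFinP.
apply: filterS cF => x /cvg_ex[l Fl].
have Fl' : (F n x)%:E @[n --> \oo] --> l%:E by apply/cvg_EFin => //; exact: nearW.
by rewrite (cvg_limn_einf_sup Fl').2.
Qed.

Section markov_basics.
Context d (X : measurableType d) (R : realType) (mu : probability X R).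
Variable P : (X -> R) -> X -> R.
Hypothesis PM : markov_operator mu P.
Implicit Types (f g h : X -> R).

Local Notation L1 := (Lfun mu 1%E).
Local Notation Int f := (Rintegral mu setT f).

Lemma markov_L1 f : f \in L1 -> P f \in L1.
Proof. exact: markov_Lfun. Qed.

Lemma markov_Int f : f \in L1 -> Int (P f) = Int f.
Proof. by move=> Lf; rewrite /Rintegral (markov_integral PM). Qed.

Lemma markovB f g : f \in L1 -> g \in L1 ->
  \forall x \ae mu, P (f - g) x = P f x - P g x.
Proof.
move=> Lf Lg; rewrite (_ : f - g = (-1) *: g + f); last first.
  by rewrite scaleN1r addrC.
apply: filterS (markov_linear PM (-1) Lg Lf) => x /(_ I) ->.
by rewrite !fctE scaleN1r addrC.
Qed.

Lemma markov0 : \forall x \ae mu, P 0 x = 0.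
Proof.
have L0 : (0 : X -> R) \in L1 by exact: rpred0.
by apply: filterS (markovB L0 L0) => x; rewrite subrr subrr.
Qed.

Lemma markovZ (c : R) f : f \in L1 -> \forall x \ae mu, P (c *: f) x = c * P f x.
Proof.
move=> Lf; have L0 : (0 : X -> R) \in L1 by exact: rpred0.
rewrite -[c *: f]addr0.
apply: filterS2 (markov_linear PM c Lf L0) markov0 => x /(_ I) -> P0.
by rewrite !fctE P0 addr0.
Qed.

Lemma markovD f g : f \in L1 -> g \in L1 ->
  \forall x \ae mu, P (f + g) x = P f x + P g x.
Proof.
move=> Lf Lg; have := markov_linear PM 1 Lf Lg; rewrite scale1r.
by apply: filterS => x /(_ I) ->; rewrite !fctE scale1r.
Qed.

Lemma markov_sum (F : nat -> X -> R) n : (forall i, F i \in L1) ->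
  \forall x \ae mu, P (\sum_(i < n) F i) x = \sum_(i < n) P (F i) x.
Proof.
move=> LF; elim: n => [|n IH].
  by rewrite big_ord0; apply: filterS markov0 => x ->; rewrite big_ord0.
rewrite big_ord_recr/=.
apply: filterS2 IH (markovD (L1_sum n LF) (LF n)) => x IH ->.
by rewrite IH big_ord_recr.
Qed.

Lemma markov_le f g : f \in L1 -> g \in L1 ->
  (\forall x \ae mu, f x <= g x) -> \forall x \ae mu, P f x <= P g x.
Proof.
move=> Lf Lg fg; have : \forall x \ae mu, 0 <= P (g - f) x.
  apply: (markov_ge0 PM); first exact: rpredB.
  by apply: filterS fg => x; rewrite !fctE subr_ge0.
by apply: filterS2 (markovB Lg Lf) => x ->; rewrite subr_ge0.
Qed.

Lemma markov_eq f g : f \in L1 -> g \in L1 ->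
  (\forall x \ae mu, f x = g x) -> \forall x \ae mu, P f x = P g x.
Proof.
move=> Lf Lg fg; have : f = g %[ae mu] by apply: filterS fg => x ->.
by move/(markov_ae_eq PM Lf Lg); apply: filterS => x ->.
Qed.

(** Continuity of [P] along monotone sequences, derived from positivity and preservation of
    integrals: [P (W n)] decreases to some [h >= 0], and [Int h <= Int (P (W n)) = Int (W n)], which
    tends to 0. *)
Lemma markov_vanish (W : nat -> X -> R) : (forall n, W n \in L1) ->
  (forall n, \forall x \ae mu, W n.+1 x <= W n x) ->
  (\forall x \ae mu, W n x @[n --> \oo] --> (0 : R)) ->
  \forall x \ae mu, P (W n) x @[n --> \oo] --> (0 : R).
Proof.
move=> LW Wd W0.
have Wge0 n : \forall x \ae mu, 0 <= W n x.
  apply: filterS2 (ae_foralln Wd) W0 => x Wdx Wx.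
  have <- : limn (W ^~ x) = 0 by exact: cvg_lim.
  apply: (@nonincreasing_cvgn_ge _ (W ^~ x)); last by apply/cvg_ex; exists 0.
  exact/nonincreasing_seqP.
have PWge0 : \forall x \ae mu, forall n, 0 <= P (W n) x.
  by apply: ae_foralln => n; exact: (markov_ge0 PM).
have PWd : \forall x \ae mu, forall n, P (W n.+1) x <= P (W n) x.
  by apply: ae_foralln => n; exact: markov_le.
have cPW : \forall x \ae mu, cvgn (fun n => P (W n) x).
  apply: filterS2 PWge0 PWd => x W0x Wdx.
  apply: nonincreasing_is_cvgn; first exact/nonincreasing_seqP.
  by exists 0 => _ [n _ <-].
have [h mh Wh] := ae_cvg_measurable (fun n => L1_measurable (markov_L1 (LW n))) cPW.
have h0 : \forall x \ae mu, 0 <= h x.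
  apply: filterS2 PWge0 Wh => x W0x Wx.
  rewrite -(cvg_lim _ Wx)//; apply: limr_ge; first by apply/cvg_ex; exists (h x).
  exact: nearW.
have hW n : \forall x \ae mu, h x <= P (W n) x.
  apply: filterS2 PWd Wh => x Wdx Wx.
  rewrite -(cvg_lim _ Wx)//; apply: (@nonincreasing_cvgn_ge _ (fun n => P (W n) x)).
    exact/nonincreasing_seqP.
  by apply/cvg_ex; exists (h x).
have Lh : h \in L1.
  apply: (L1_le mh (markov_L1 (LW 0%N))).
  by apply: filterS2 h0 (hW 0%N) => x hx; rewrite ger0_norm.
have IW : Int (W n) @[n --> \oo] --> (0 : R).
  have [|||||_] := @dominated_cvg_Int _ _ _ mu W (cst 0) (W 0%N) => //.
  - by move=> n; exact: L1_measurable.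
  - move=> n; apply: filterS2 (Wge0 n) (ae_foralln Wd) => x Wn Wdx.
    rewrite ger0_norm//; elim: n {Wn} => // n IH.
    exact: le_trans IH.
  - by rewrite Int_cst.
have hz : \forall x \ae mu, h x = 0.
  apply: Int_le0 => //.
  rewrite -(cvg_lim _ IW)//; apply: limr_ge; first by apply/cvg_ex; exists 0.
  apply: nearW => n; rewrite -(markov_Int (LW n)); apply: (le_Int Lh (markov_L1 (LW n)) (hW n)).
by apply: filterS2 hz Wh => x ->.
Qed.

Lemma markov_cvg_nd (F : nat -> X -> R) f : (forall n, F n \in L1) -> f \in L1 ->
  (forall n, \forall x \ae mu, F n x <= F n.+1 x) ->
  (\forall x \ae mu, F n x @[n --> \oo] --> f x) ->
  \forall x \ae mu, P (F n) x @[n --> \oo] --> P f x.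
Proof.
move=> LF Lf Fd Ff.
have PB : \forall x \ae mu, forall n, P (f - F n) x = P f x - P (F n) x.
  by apply: ae_foralln => n; exact: markovB.
have H : \forall x \ae mu, P (f - F n) x @[n --> \oo] --> (0 : R).
  apply: (@markov_vanish (fun n => f - F n)); first by move=> n; rewrite rpredB.
    by move=> n; apply: filterS (Fd n) => x; rewrite !fctE lerD2l lerN2.
  apply: filterS Ff => x Ff; rewrite -(subrr (f x)).
  exact: (cvgB (cvg_cst (f x)) Ff).
apply: filterS2 PB H => x PBx Hx.
rewrite (_ : (fun n => P (F n) x) = (fun n => P f x - P (f - F n) x)); last first.
  by apply/funext => n; rewrite PBx subKr.
by rewrite -[X in _ --> X]subr0; apply: cvgB => //; exact: cvg_cst.
Qed.

Lemma markov_cvg_ni (F : nat -> X -> R) f : (forall n, F n \in L1) -> f \in L1 ->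
  (forall n, \forall x \ae mu, F n.+1 x <= F n x) ->
  (\forall x \ae mu, F n x @[n --> \oo] --> f x) ->
  \forall x \ae mu, P (F n) x @[n --> \oo] --> P f x.
Proof.
move=> LF Lf Fd Ff.
have PB : \forall x \ae mu, forall n, P (F n - f) x = P (F n) x - P f x.
  by apply: ae_foralln => n; exact: markovB.
have H : \forall x \ae mu, P (F n - f) x @[n --> \oo] --> (0 : R).
  apply: (@markov_vanish (fun n => F n - f)); first by move=> n; rewrite rpredB.
    by move=> n; apply: filterS (Fd n) => x; rewrite !fctE lerD2r.
  apply: filterS Ff => x Ff; rewrite -(subrr (f x)).
  exact: (cvgB Ff (cvg_cst (f x))).
apply: filterS2 PB H => x PBx Hx.
rewrite (_ : (fun n => P (F n) x) = (fun n => P (F n - f) x + P f x)); last first.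
  by apply/funext => n; rewrite PBx subrK.
by rewrite -[X in _ --> X]add0r; apply: cvgD => //; exact: cvg_cst.
Qed.

End markov_basics.

(** * Iterates of a Markov operator *)

Section markov_iterates.
Context d (X : measurableType d) (R : realType) (mu : probability X R).
Variable P : (X -> R) -> X -> R.
Hypothesis PM : markov_operator mu P.

Local Notation L1 := (Lfun mu 1%E).

Lemma markov_iter n : markov_operator mu (iter n P).
Proof.
elim: n => [|n IH].
  split => //=; first by move=> a f g Lf Lg; apply: aeW.
split.
- by move=> f Lf; exact/(markov_Lfun PM)/(markov_Lfun IH).
- move=> f g Lf Lg fg; apply: (markov_ae_eq PM); try exact: (markov_Lfun IH).
  exact: (markov_ae_eq IH).
- move=> a f g Lf Lg /=.
  have Pf := markov_Lfun IH Lf; have Pg := markov_Lfun IH Lg.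
  have /(markov_ae_eq PM) := markov_linear IH a Lf Lg.
  have Lfg : a *: f + g \in L1 by rewrite rpredD// rpredZ.
  move=> /(_ (markov_Lfun IH Lfg)); rewrite rpredD ?rpredZ// => /(_ isT).
  by apply: filterS2 (markov_linear PM a Pf Pg) => x + + _ => /(_ I) <- /(_ I).
- by move=> f Lf f0; apply: (markov_ge0 PM); [exact: (markov_Lfun IH)|exact: (markov_ge0 IH)].
- by move=> f Lf; rewrite /= (markov_integral PM) ?(markov_integral IH)//; exact: (markov_Lfun IH).
Qed.

Hypothesis P1 : P \1_[set: X] = \1_[set: X] %[ae mu].

Lemma markov_cst (c : R) : \forall x \ae mu, P (cst c) x = c.
Proof.
rewrite (_ : cst c = c *: (\1_[set: X] : X -> R)); last first.
  by apply/funext => x; rewrite !fctE indicT/= /GRing.scale/= mulr1.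
have L := @L1_indic _ _ _ mu _ (measurableT : measurable [set: X]).
apply: filterS2 (markovZ PM c L) P1 => x -> /(_ I) ->.
by rewrite indicT mulr1.
Qed.

Lemma markov_iter1 n : iter n P \1_[set: X] = \1_[set: X] %[ae mu].
Proof.
elim: n => [|n IH]; first exact: aeW.
have L := @L1_indic _ _ _ mu _ (measurableT : measurable [set: X]).
have /= := markov_ae_eq PM (markov_L1 (markov_iter n) L) L IH.
by apply: filterS2 P1 => x + + _ => /(_ I) <- /(_ I).
Qed.

End markov_iterates.

(** * The maximal inequality *)

(** Index 0 is included, which forces [psi 0 <= 0] almost everywhere. *)
Definition superadditive d (X : measurableType d) (R : realType)
    (mu : probability X R) (P : (X -> R) -> X -> R) (psi : nat -> X -> R) :=
  forall n m, \forall x \ae mu, psi n x + iter n P (psi m) x <= psi (n + m)%N x.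

Section superadditive.
Context d (X : measurableType d) (R : realType) (mu : probability X R).
Variable P : (X -> R) -> X -> R.
Hypothesis PM : markov_operator mu P.

Local Notation L1 := (Lfun mu 1%E).
Local Notation Int f := (Rintegral mu setT f).

Variables (psi : nat -> X -> R) (s : R).
Hypothesis Lpsi : forall n, psi n \in L1.
Hypothesis psi0 : forall n, \forall x \ae mu, 0 <= psi n x.
Hypothesis psiS : superadditive mu P psi.
Hypothesis Ipsi : forall n, Int (psi n) <= n%:R * s.

(* Fatou gives [P w <= w]; equality follows since both have the same integral. *)
Lemma superadditive_liminf : exists w, [/\ w \in L1, \forall x \ae mu, 0 <= w x,
  \forall x \ae mu, P w x = w x &
  \forall x \ae mu,
    (w x)%:E = limn_einf (fun n => (n.+1%:R^-1 * psi n.+1 x)%:E)].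
Proof.
pose u n : X -> R := n.+1%:R^-1 *: psi n.+1.
have Lu n : u n \in L1 by rewrite rpredZ.
have u0 n : \forall x \ae mu, 0 <= u n x.
  by apply: filterS (psi0 n.+1) => x px; rewrite /u !fctE mulr_ge0.
have Iu n : Int (u n) <= s.
  by rewrite IntZ// mulrC ler_pdivrMr// mulrC.
have [w [Lw w0 _ wE]] := fatou_Int Lu u0 Iu (cvg_cst s).
exists w; split=> //.
(* [P] passes to monotone limits, so the lower limit is replaced by the infima over [k >= n], which
   increase to [w]. *)
pose v n x := fine (einfs (fun k => (u k x)%:E) n).
have mv n : measurable_fun setT (v n).
  apply: measurableT_comp; first exact: fine_measurable.
  by apply: measurable_fun_einfs => k; apply/measurable_EFinP; exact: L1_measurable (Lu k).
have vE : \forall x \ae mu, forall n, einfs (fun k => (u k x)%:E) n = (v n x)%:E /\ 0 <= v n x <= w x.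
  apply: filterS2 wE (ae_foralln u0) => x wx ux n.
  have en0 : (0 <= einfs (fun k => (u k x)%:E) n)%E.
    by apply: le_ereal_inf_tmp => _ [m _ <-]; rewrite lee_fin.
  have enw : (einfs (fun k => (u k x)%:E) n <= (w x)%:E)%E.
    by rewrite wx; exact: einfs_le_limn_einf.
  have enE : einfs (fun k => (u k x)%:E) n = (v n x)%:E.
    by rewrite /v fineK// ge0_fin_numE// (le_lt_trans enw)// ltry.
  by split=> //; rewrite -!lee_fin -enE en0.
have Lv n : v n \in L1.
  apply: (L1_le (mv n) Lw); apply: filterS vE => x /(_ n)[_ /andP[v0 vw]].
  by rewrite ger0_norm.
have vu n k : (n <= k)%N -> \forall x \ae mu, v n x <= u k x.
  move=> nk; apply: filterS vE => x /(_ n)[vn _]; rewrite -lee_fin -vn.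
  by apply: ereal_inf_lbound; exists k.
have Pv : \forall x \ae mu, P (v n) x @[n --> \oo] --> P w x.
  apply: (markov_cvg_nd PM) => //.
    move=> n; apply: filterS vE => x vx; rewrite -lee_fin -(vx n).1 -(vx n.+1).1.
    exact: nondecreasing_einfs.
  apply: filterS2 vE wE => x vx wx; apply/fine_cvg.
  rewrite wx limn_einf_lim; exact: is_cvg_einfs.
(* Superadditivity with first index 1, after dropping [psi 1 >= 0], gives
   [P (psi k.+1) <= psi k.+2]. The denominator stays [k.+1], one less than in [u k.+1]. *)
have Pvu : \forall x \ae mu, forall n k, (n <= k)%N ->
    P (v n) x <= k.+1%:R^-1 * psi k.+2 x.
  apply: ae_foralln => n; apply: ae_foralln => k.
  have [nk|kn] := leqP n k; last exact: aeW.
  have h1 := markov_le PM (Lv n) (Lu k) (vu _ _ nk).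
  have h2 := markovZ PM k.+1%:R^-1 (Lpsi k.+1).
  have h3 := psiS 1 k.+1.
  apply: filterS3 h1 h2 (filterI h3 (psi0 1)) => x p1 p2 [p3 p4] _.
  apply: (le_trans p1); rewrite p2 ler_wpM2l//.
  by apply: le_trans p3; rewrite lerDr.
have Pv0 : \forall x \ae mu, forall n, 0 <= P (v n) x.
  apply: ae_foralln => n; apply: (markov_ge0 PM) => //.
  by apply: filterS vE => x /(_ n)[_ /andP[]].
have Pw : \forall x \ae mu, P w x <= w x.
  apply: filterS3 Pv vE (filterI Pvu Pv0) => x Pvx vx [Pvux Pv0x].
  rewrite -(cvg_lim _ Pvx)//; apply: limr_le; first by apply/cvg_ex; exists (P w x).
  apply: nearW => n; set p := P (v n) x.
  (* The ratio of the two denominators is 1 - 1 / (k + 2), hence a loss of at most [p * harmonic N],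
     which vanishes in the limit. *)
  have hN : \forall N \near \oo, p - p * harmonic N <= w x.
    exists n.+1 => // N /= nN; have [_ /andP[_]] := vx N; apply: le_trans.
    rewrite -lee_fin -(vx N).1; apply: le_ereal_inf_tmp => _ [k /= Nk <-].
    rewrite lee_fin /u fctE.
    have nk : (n < k)%N by exact: leq_trans Nk.
    case: k => // k in Nk nk *.
    have pk : p * k.+1%:R <= psi k.+2 x.
      by rewrite -ler_pdivlMr// mulrC; exact: Pvux.
    rewrite -[_ *: _]/(_ * _) [leRHS]mulrC ler_pdivlMr//; apply: le_trans pk.
    have -> : p * k.+1%:R = (p - p * k.+2%:R^-1) * k.+2%:R.
      by rewrite mulrBl mulfVK// -[k.+2]addn1 natrD; ring.
    rewrite ler_wpM2r// lerD2l lerN2 ler_wpM2l//; first exact: Pv0x.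
    by rewrite lef_pV2 ?posrE// ler_nat.
  have cN : p - p * harmonic N @[N --> \oo] --> p.
    rewrite -[X in _ --> X]subr0 -[X in _ - X](mulr0 p).
    apply: cvgB; first exact: cvg_cst.
    by apply: cvgMr; exact: cvg_harmonic.
  rewrite -(cvg_lim _ cN)//; apply: limr_le => //.
  by apply/cvg_ex; exists p.
apply: le_Int_ae_eq => //; first exact: markov_L1 PM _ _.
by rewrite (markov_Int PM).
Qed.

Variable v : X -> R.
Hypothesis Lv : v \in L1.
Hypothesis v0 : \forall x \ae mu, 0 <= v x.
Hypothesis Pv : \forall x \ae mu, P v x <= v x.

Let reach M := [set x | exists2 n, (0 < n <= M)%N & n%:R * v x <= psi n x].

Let measurable_reach M : measurable (reach M).
Proof.
apply: measurable_exists_le; first exact: L1_measurable Lv.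
by move=> n; exact: L1_measurable (Lpsi n).
Qed.

(** A jump of length [n] may overshoot the range [k]; the truncated subtraction then empties the
    last sum, and nonnegativity absorbs the excess. *)
Let le_sum_shift (a : nat -> R) (c : R) n k : (forall j, 0 <= a j) ->
  \sum_(j < n) a j <= c ->
  \sum_(j < k) a j <= c + \sum_(j < k - n) a (n + j)%N.
Proof.
move=> a0 ac; apply: (@le_trans _ _ (\sum_(j < n) a j + \sum_(j < k - n) a (n + j)%N)).
  have [kn|/ltnW nk] := leqP k n.
    rewrite (_ : k - n = 0)%N; last by apply/eqP; rewrite subn_eq0.
    rewrite big_ord0 addr0 -(subnKC kn) big_split_ord/= lerDl.
    by apply: sumr_ge0 => j _; exact: a0.
  by rewrite -[in leLHS](subnKC nk) big_split_ord.
by rewrite lerD2r.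
Qed.

Let maximal_reach M : Int (v * \1_(reach M)) <= s.
Proof.
set h := v * \1_(reach M).
have Lh : h \in L1 by exact: L1_indicM.
have h0 : \forall x \ae mu, 0 <= h x.
  by apply: filterS v0 => x v0x; rewrite /h fctE mulr_ge0.
have hv : \forall x \ae mu, h x <= v x.
  by apply: filterS v0 => x v0x; rewrite /h fctE ler_piMr// indicE; case: (_ \in _).
have Lit j : iter j P h \in L1 := markov_L1 (markov_iter PM j) Lh.
have it0 : \forall x \ae mu, forall j, 0 <= iter j P h x.
  by apply: ae_foralln => j; exact: (markov_ge0 (markov_iter PM j)).
have Litv j : iter j P v \in L1 := markov_L1 (markov_iter PM j) Lv.
have itvv j : \forall x \ae mu, iter j P v x <= v x.
  elim: j => [|j IH]; first by apply: aeW => x /=.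
  by apply: filterS2 Pv (markov_le PM (Litv j) Lv IH) => x Pvx /le_trans; exact.
have itv : \forall x \ae mu, forall j, iter j P h x <= v x.
  apply: ae_foralln => j; apply: filterS2 (itvv j) (markov_le (markov_iter PM j) Lh Lv hv).
  by move=> x vx /le_trans; exact.
pose S k : X -> R := \sum_(j < k) iter j P h.
have LS k : S k \in L1 by exact: L1_sum.
have PS n k : \forall x \ae mu, iter n P (S k) x = \sum_(j < k) iter (n + j) P h x.
  apply: filterS (markov_sum (markov_iter PM n) k Lit) => x ->.
  by apply: eq_bigr => j _; rewrite -iterD.
have SE k x : S k x = \sum_(j < k) iter j P h x by rewrite /S fct_sumE.
(* On [reach M], jump by the [n] which witnesses membership; elsewhere [h = 0]
   and a single step loses nothing. *)
have claim N : \forall x \ae mu, S (N - M)%N x <= psi N x.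
  elim/ltn_ind: N => N IH; have [NM|MN] := leqP N M.
    apply: filterS (psi0 N) => x; rewrite SE (_ : N - M = 0)%N ?big_ord0//.
    by apply/eqP; rewrite subn_eq0.
  (* The inequality holds for all [n] simultaneously off one null set, so [n] may afterwards be
     chosen according to the point; [P] is never applied to a function built from that choice. *)
  have step : \forall x \ae mu, forall n, (0 < n <= N)%N ->
      psi n x + \sum_(j < N - M - n) iter (n + j) P h x <= psi N x.
    apply: ae_foralln => n; have [/andP[n0 nN]|nn] := boolP (0 < n <= N)%N; last first.
      exact: aeW.
    have IHn : \forall x \ae mu, S (N - n - M)%N x <= psi (N - n)%N x.
      by apply: IH; rewrite ltn_subrL n0 (leq_ltn_trans _ MN).
    have := psiS n (N - n)%N; rewrite subnKC//.
    apply: filterS3 (PS n (N - n - M)%N) (markov_le (markov_iter PM n) (LS _) (Lpsi _) IHn).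
    move=> x + + + _; rewrite subnAC => -> h1; apply: le_trans.
    by rewrite lerD2l.
  apply: filterS3 step (filterI it0 itv) (psi0 1) => x stepx [it0x itvx] p1.
  rewrite SE.
  have [[n /andP[n0 nM] nv]|xM] := pselect (reach M x).
    apply: le_trans (stepx n _); last by rewrite n0 (leq_trans nM)// ltnW.
    apply: (@le_sum_shift (fun j => iter j P h x)) => //; apply: le_trans nv.
    (* This is where [P v <= v] enters: each [iter j P h x] is at most [v x], so the first [n] terms
       cost at most [n%:R * v x], which [psi n x] covers. *)
    apply: (@le_trans _ _ (\sum_(j < n) v x)); first exact: ler_sum.
    by rewrite sumr_const card_ord mulr_natl.
  apply: le_trans (stepx 1 _); last by rewrite (leq_ltn_trans _ MN).
  apply: (@le_sum_shift (fun j => iter j P h x)) => //; rewrite big_ord1/= /h fctE indicE memNset// mulr0//.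
have IS k : Int (S k) = k%:R * Int h.
  rewrite Int_sum//; under eq_bigr do rewrite (markov_Int (markov_iter PM _))//.
  by rewrite sumr_const card_ord mulr_natl.
have bound k : k%:R * Int h <= (M + k)%:R * s.
  rewrite -IS; apply: le_trans (Ipsi _); apply: le_Int => //.
  by have := claim (M + k)%N; rewrite addKn.
(* [bound] reads k (Int h - s) <= M s for every k. The loss of [M] terms at the end does not grow
   with k, so [Int h > s] is impossible. *)
rewrite leNgt; apply/negP => sh.
have s0 : 0 <= s by have := Ipsi 1; rewrite mul1r; apply: le_trans; exact: Int_ge0.
have hs0 : 0 < Int h - s by rewrite subr_gt0.
have := archi_boundP (divr_ge0 (mulr_ge0 (ler0n R M) s0) (ltW hs0)).
set k := Num.bound _; rewrite ltr_pdivrMr//; apply/negP; rewrite -leNgt.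
by have := bound k; rewrite natrD mulrDl mulrBr -lerBlDr.
Qed.

Lemma superadditive_maximal :
  Int (v * \1_[set x | exists2 n, (0 < n)%N & n%:R * v x <= psi n x]) <= s.
Proof.
set A := [set x | _].
have [|||||_ cI] := @dominated_cvg_Int _ _ _ mu (fun M => v * \1_(reach M)) (v * \1_A) v.
- by move=> M; apply: L1_measurable; exact: (L1_indicM (measurable_reach M) Lv).
- apply: measurable_funM; first exact: L1_measurable Lv.
  apply: measurable_indic; apply: measurable_exists_le; first exact: L1_measurable Lv.
  by move=> n; exact: L1_measurable (Lpsi n).
- exact: Lv.
- move=> M; apply: filterS v0 => x v0x; rewrite fctE normrM (ger0_norm v0x) ler_piMr//.
  by rewrite indicE; case: (_ \in _); rewrite /= ?normr1 ?normr0.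
- apply: aeW => x; apply: cvg_near_cst.
  have [[n n0 nv]|xA] := pselect (A x).
    exists n => // M /= nM; rewrite !fctE !indicE !mem_set//; first by exists n.
    by exists n => //; rewrite n0.
  apply: nearW => M; rewrite !fctE !indicE !memNset// => -[n /andP[n0 _] nv].
  by apply: xA; exists n.
rewrite -(cvg_lim _ cI)//; apply: limr_le; first by apply/cvg_ex; eexists; exact: cI.
by apply: nearW => M; exact: maximal_reach.
Qed.

End superadditive.

(** * The ergodic theorem for bounded functions *)

Lemma limn_einf_near (R : realType) (u : nat -> \bar R) (l e : R) :
  l%:E = limn_einf u -> 0 < e -> \forall n \near \oo, ((l - e)%:E <= u n)%E.
Proof.
move=> lu e0; have : ((l - e)%:E < ereal_sup (range (einfs u)))%E.
  rewrite -(cvg_lim _ (@cvg_einfs_sup _ u))// -limn_einf_lim -lu lte_fin.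
  by rewrite ltrBlDr ltrDl.
move=> /ereal_sup_gt[_ [N _ <-] lN]; exists N => // n /= Nn.
by apply: (le_trans (ltW lN)); apply: ereal_inf_lbound; exists n.
Qed.

Definition birkhoff (X : Type) (R : realType) (P : (X -> R) -> X -> R)
  (f : X -> R) (n : nat) : X -> R := \sum_(j < n) iter j P f.

Section birkhoff.
Context d (X : measurableType d) (R : realType) (mu : probability X R).
Variable P : (X -> R) -> X -> R.
Hypothesis PM : markov_operator mu P.

Local Notation L1 := (Lfun mu 1%E).
Local Notation Int f := (Rintegral mu setT f).
Local Notation S := (birkhoff P).
Implicit Types (f g : X -> R).

Let Lit f j : f \in L1 -> iter j P f \in L1.
Proof. exact: markov_L1 (markov_iter PM j) _. Qed.

Lemma birkhoffE f n x : S f n x = \sum_(j < n) iter j P f x.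
Proof. by rewrite /birkhoff fct_sumE. Qed.

Lemma L1_birkhoff f n : f \in L1 -> S f n \in L1.
Proof. by move=> Lf; apply: (@L1_sum _ _ _ _ (fun j => iter j P f)) => j; exact: Lit. Qed.

Lemma Int_birkhoff f n : f \in L1 -> Int (S f n) = n%:R * Int f.
Proof.
move=> Lf; rewrite (@Int_sum _ _ _ _ (fun j => iter j P f)); last by move=> j; exact: Lit.
under eq_bigr do rewrite (markov_Int (markov_iter PM _))//.
by rewrite sumr_const card_ord mulr_natl.
Qed.

Lemma birkhoff_ge0 f n : f \in L1 -> (\forall x \ae mu, 0 <= f x) ->
  \forall x \ae mu, 0 <= S f n x.
Proof.
move=> Lf f0; have : \forall x \ae mu, forall j, 0 <= iter j P f x.
  by apply: ae_foralln => j; exact: (markov_ge0 (markov_iter PM j)).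
by apply: filterS => x Pf; rewrite birkhoffE sumr_ge0.
Qed.

Lemma birkhoff_additive f n m : f \in L1 ->
  \forall x \ae mu, S f n x + iter n P (S f m) x = S f (n + m)%N x.
Proof.
move=> Lf; have := markov_sum (markov_iter PM n) m (fun j => Lit j Lf).
apply: filterS => x ->; rewrite !birkhoffE big_split_ord/=; congr (_ + _).
by apply: eq_bigr => j _; rewrite iterD.
Qed.

Lemma birkhoff_superadditive f : f \in L1 -> superadditive mu P (S f).
Proof. by move=> Lf n m; apply: filterS (birkhoff_additive n m Lf) => x ->. Qed.

Lemma birkhoffB f g n : f \in L1 -> g \in L1 ->
  \forall x \ae mu, S (f - g) n x = S f n x - S g n x.
Proof.
move=> Lf Lg.
have := ae_foralln (fun j => markovB (markov_iter PM j) Lf Lg).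
by apply: filterS => x Px; rewrite !birkhoffE -sumrB/=; apply: eq_bigr => j _.
Qed.

Lemma birkhoff_le f g n : f \in L1 -> g \in L1 -> (\forall x \ae mu, f x <= g x) ->
  \forall x \ae mu, S f n x <= S g n x.
Proof.
move=> Lf Lg fg.
have := ae_foralln (fun j => markov_le (markov_iter PM j) Lf Lg fg).
by apply: filterS => x Px; rewrite !birkhoffE; apply: ler_sum => j _.
Qed.

Hypothesis P1 : P \1_[set: X] = \1_[set: X] %[ae mu].

Lemma birkhoff_cst (c : R) n : \forall x \ae mu, S (cst c) n x = n%:R * c.
Proof.
have := ae_foralln (fun j => markov_cst (markov_iter PM j) (markov_iter1 PM P1 j) c).
apply: filterS => x Px; rewrite birkhoffE; under eq_bigr do rewrite Px.
by rewrite sumr_const card_ord mulr_natl.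
Qed.

(* The maximal inequality is applied to the Birkhoff sums of [C + e - b] and to
   the invariant function [C - w], where [w] is the lower limit for [b]. *)
Let ergodic_liminf b (C : R) : b \in L1 ->
  (\forall x \ae mu, 0 <= b x <= C) ->
  exists w, [/\ w \in L1, Int b <= Int w & \forall x \ae mu, forall e, 0 < e ->
    \forall n \near \oo, w x - e <= n.+1%:R^-1 * S b n.+1 x].
Proof.
move=> Lb bC.
have b0 : \forall x \ae mu, 0 <= b x by apply: filterS bC => x /andP[].
have Sb0 n : \forall x \ae mu, 0 <= S b n x by exact: birkhoff_ge0.
have Ib n : Int (S b n) <= n%:R * Int b by rewrite Int_birkhoff.
have [w [Lw w0 Pw wE]] := superadditive_liminf PM (fun n => L1_birkhoff n Lb) Sb0
  (birkhoff_superadditive Lb) Ib.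
exists w; split=> //; last first.
  apply: filterS wE => x wx e e0.
  by apply: filterS (limn_einf_near wx e0) => n; rewrite lee_fin.
apply/ler_addgt0Pr => e e0.
have LC := L1_cst mu C; have LCe := L1_cst mu (C + e).
have SbC : \forall x \ae mu, forall n, S b n x <= n%:R * C.
  apply: ae_foralln => n; have := birkhoff_cst C n.
  have bC' : \forall x \ae mu, b x <= C by apply: filterS bC => x /andP[].
  by apply: filterS2 (birkhoff_le n Lb LC bC') => x + <-.
have wC : \forall x \ae mu, w x <= C.
  apply: filterS2 wE SbC => x wx Sx; apply/ler_addgt0Pr => r r0.
  have [N _ /(_ N (leqnn N))/=] := limn_einf_near wx r0.
  rewrite lee_fin lerBlDr => /le_trans; apply; rewrite lerD2r.
  by rewrite mulrC ler_pdivrMr// mulrC.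
pose b' := cst (C + e) - b.
have Lb' : b' \in L1 by exact: rpredB.
have b'0 : \forall x \ae mu, 0 <= b' x.
  apply: filterS bC => x /andP[_ bC]; rewrite /b' !fctE/= subr_ge0.
  by rewrite (le_trans bC)// lerDl ltW.
have Sb' : \forall x \ae mu, forall n, S b' n x = n%:R * (C + e) - S b n x.
  apply: ae_foralln => n; have := birkhoff_cst (C + e) n.
  by apply: filterS2 (birkhoffB n LCe Lb) => x -> ->.
have Ib' n : Int (S b' n) <= n%:R * (C + e - Int b).
  by rewrite Int_birkhoff// IntB// Int_cst.
have Sb'0 n : \forall x \ae mu, 0 <= S b' n x by exact: birkhoff_ge0.
pose v := cst C - w; have Lv : v \in L1 by exact: rpredB.
have v0 : \forall x \ae mu, 0 <= v x.
  by apply: filterS wC => x; rewrite /v !fctE subr_ge0.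
have Pv : \forall x \ae mu, P v x <= v x.
  apply: filterS3 (markovB PM LC Lw) (markov_cst PM P1 C) Pw => x.
  by rewrite /v !fctE => -> -> ->.
have := superadditive_maximal PM (fun n => L1_birkhoff n Lb') Sb'0
  (birkhoff_superadditive Lb') Ib' Lv v0 Pv.
(* Off [A] every average of [b] would exceed [w + e], although [w] is their lower limit. Hence [A]
   has full measure, and the maximal inequality becomes C - Int w <= C + e - Int b. *)
set A := [set x | _]; rewrite (_ : Int (v * \1_A) = Int v); last first.
  have mA : measurable A.
    apply: measurable_exists_le; first exact: L1_measurable Lv.
    by move=> n; exact: L1_measurable (L1_birkhoff n Lb').
  apply: Int_ae_eq => //; first exact: L1_indicM.
  apply: filterS2 wE Sb' => x wx Sx; rewrite fctE indicE mem_set ?mulr1//.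
  apply: contrapT => nA.
  have : ((w x + e)%:E <= limn_einf (fun n => (n.+1%:R^-1 * S b n.+1 x)%:E))%E.
    apply: le_trans (einfs_le_limn_einf _ 0).
    apply: le_ereal_inf_tmp => _ [n _ <-]; rewrite lee_fin leNgt; apply/negP => lt.
    apply: nA; exists n.+1 => //; rewrite Sx /v !fctE.
    move: lt; rewrite mulrC ltr_pdivrMr// mulrC => lt.
    by rewrite mulrBr mulrDr; move: lt; rewrite mulrDr; lra.
  by rewrite -wx lee_fin leNgt ltrDl e0.
by rewrite IntB// Int_cst; lra.
Qed.

(** Applying the lower estimate to [b] and to [C - b] gives, up to any e, an eventual lower bound
    [w] and an eventual upper bound [v] of the averages, with Int v <= Int b <= Int w. Since
    [w <= v], the two coincide. *)
Lemma ergodic_bounded b (C : R) : b \in L1 -> (\forall x \ae mu, 0 <= b x <= C) ->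
  exists w, [/\ w \in L1, Int w = Int b &
    \forall x \ae mu, n.+1%:R^-1 * S b n.+1 x @[n --> \oo] --> w x].
Proof.
move=> Lb bC; have [w [Lw Iw wb]] := ergodic_liminf Lb bC.
have LC := L1_cst mu C.
pose b' := cst C - b; have Lb' : b' \in L1 by exact: rpredB.
have b'C : \forall x \ae mu, 0 <= b' x <= C.
  by apply: filterS bC => x; rewrite /b' !fctE; lra.
have [w' [Lw' Iw' w'b]] := ergodic_liminf Lb' b'C.
have Sb' : \forall x \ae mu, forall n, S b' n x = n%:R * C - S b n x.
  apply: ae_foralln => n; have := birkhoff_cst C n.
  by apply: filterS2 (birkhoffB n LC Lb) => x -> ->.
have bw' : \forall x \ae mu, forall e, 0 < e ->
    \forall n \near \oo, n.+1%:R^-1 * S b n.+1 x <= C - w' x + e.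
  apply: filterS2 w'b Sb' => x w'x Sx e e0; apply: filterS (w'x e e0) => n.
  by rewrite Sx mulrBr mulKf//; set t := _ * S b _ _ => h; lra.
pose v := cst C - w'; have Lv : v \in L1 by exact: rpredB.
have wv : \forall x \ae mu, w x = v x.
  apply: le_Int_ae_eq => //.
    apply: filterS2 wb bw' => x wx w'x; apply/ler_addgt0Pr => e e0.
    have e2 : 0 < e / 2 by rewrite divr_gt0.
    have [N _ /(_ N (leqnn N))/= [h1 h2]] := filterI (wx _ e2) (w'x _ e2).
    by have := le_trans h1 h2; rewrite /v !fctE/=; lra.
  by rewrite IntB// Int_cst; move: Iw'; rewrite IntB// Int_cst; lra.
have Ivw : Int w = Int v by exact: Int_ae_eq.
exists w; split=> //.
  apply/le_anti; rewrite Iw andbT Ivw IntB// Int_cst.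
  by move: Iw'; rewrite IntB// Int_cst; lra.
apply: filterS3 wv wb bw' => x wvx wx w'x; apply/cvgrPdist_le => e e0.
apply: filterS2 (wx e e0) (w'x e e0) => n; rewrite ler_distlC wvx => h1 h2.
by apply/andP; split.
Qed.

End birkhoff.

(** * Interpolation along multiples of an integer *)

(** An index n' with k m <= n' < (k + 1) m is bounded above through k m and below through (k + 1) m,
    both gaps being at most m. The constant 7 comes from the lower bound: the errors in [F], [S] and
    [G] cost at most 2 n' e each, and replacing (k + 1) w by n' w / m costs |w| <= n' e. *)
Lemma cvg_interpolation (R : realType) (m : nat) (e w : R) (F S G : nat -> R) :
  (0 < m)%N -> 0 < e ->
  (forall k, `|F (k * m)%N - S k| <= k%:R * (m%:R * e)) ->
  (forall n i, (i <= m)%N -> F (n + i)%N <= F n + G n) ->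
  (\forall k \near \oo, `|k.+1%:R^-1 * S k.+1 - w| <= e) ->
  n.+1%:R^-1 * G n @[n --> \oo] --> (0 : R) ->
  \forall n \near \oo, `|n.+1%:R^-1 * F n.+1 - w / m%:R| <= 7 * e.
Proof.
move=> m0 e0 FS FG Sw G0.
have e0' := ltW e0; have [N1 _ HN1] := Sw.
have /cvgrPdist_le /(_ e e0) [N2 _ HN2] := G0.
pose N3 := Num.bound (`|w| / e).
have wN3 : `|w| <= N3%:R * e.
  by rewrite -ler_pdivrMr// ltW// archi_boundP// divr_ge0.
(* [N3] ensures |w| <= n' e, [N2] the bound on [G] both at n' and at k m, and the multiple of [m]
   ensures [N1 < k]; the last [m] makes up for the remainder [i]. *)
exists (N3 + (N2 + (N1.+2) * m) + m)%N => // n /=; set n' := n.+1 => nN.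
have n'E := divn_eq n' m; set k := (n' %/ m)%N in n'E; set i := (n' %% m)%N in n'E.
have im : (i < m)%N by rewrite ltn_mod.
have n'N2 : (N2 <= n')%N by move: nN; clear; lia.
have m0R : 0 < m%:R :> R by rewrite ltr0n.
have n0R : 0 < n'%:R :> R by rewrite ltr0n.
have m1R : 1 <= m%:R :> R by rewrite ler1n.
have knN : (N2 + N1.+2 * m <= k * m)%N.
  by move: nN im; rewrite -ltnS -/n' {1}n'E; clear; lia.
have kN : (N1 < k)%N.
  by rewrite -(ltn_pmul2r m0); move: knN m0; clear; lia.
have SE j : (N1 < j)%N -> `|S j - j%:R * w| <= j%:R * e.
  case: j => // j jN; have := HN1 j jN.
  have j0 : 0 < j.+1%:R :> R by [].
  rewrite -[X in X <= _ -> _](mulKf (lt0r_neq0 j0)) -{2}(gtr0_norm j0) -normrM.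
  by rewrite mulrBr mulVKf ?lt0r_neq0// ler_pdivrMl.
have GE j : (N2 <= j)%N -> G j <= (j%:R + 1) * e.
  move=> jN; have := HN2 j jN; rewrite sub0r normrN => /(le_trans (ler_norm _)).
  by rewrite mulrC ler_pdivrMr// mulrC natr1.
have wn : `|w| <= n'%:R * e.
  apply: le_trans wN3 _; rewrite ler_wpM2r// ler_nat; move: nN; rewrite /n'; clear; lia.
have nk : n'%:R = k%:R * m%:R + i%:R :> R by rewrite {1}n'E natrD natrM.
have iR : i%:R <= m%:R :> R by rewrite ler_nat ltnW.
have i0R : 0 <= i%:R :> R by [].
have k1R : 1 <= k%:R :> R by rewrite ler1n (leq_ltn_trans _ kN).
have kw j : `|j%:R * m%:R - n'%:R| <= m%:R :> R -> `|j%:R * w - n'%:R * (w / m%:R)| <= `|w|.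
  have -> : j%:R * w - n'%:R * (w / m%:R) = (j%:R * m%:R - n'%:R) / m%:R * w.
    by field; rewrite lt0r_neq0.
  move=> jm; rewrite normrM ler_piMl// normrM normfV (gtr0_norm m0R).
  by rewrite ler_pdivrMr ?mul1r.
have kw1 := kw k; have kw2 := kw k.+1.
have up : F n' <= n'%:R * (w / m%:R) + n'%:R * (7 * e).
  have h1 : F n' <= F (k * m)%N + G (k * m)%N by rewrite {1}n'E FG// ltnW.
  have /ler_normlP[_ h2] := FS k.
  have /ler_normlP[_ h3] := SE k kN.
  have h4 : G (k * m)%N <= ((k * m)%:R + 1) * e.
    by apply: GE; apply: leq_trans knN; exact: leq_addr.
  have {kw1}/kw1/ler_normlP[_ h5] : `|k%:R * m%:R - n'%:R| <= m%:R :> R.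
    by rewrite nk opprD addNKr normrN ger0_norm.
  move: h4; rewrite natrM => h4.
  have h6 : k%:R * e <= n'%:R * e by rewrite ler_wpM2r// nk; nra.
  have h7 : k%:R * m%:R * e <= n'%:R * e by rewrite ler_wpM2r// nk; lra.
  have h8 : e <= n'%:R * e by rewrite ler_peMl// ler1n.
  by move: h2 h3 h4 h5; lra.
have lo : n'%:R * (w / m%:R) - n'%:R * (7 * e) <= F n'.
  have h1 : F (k.+1 * m)%N <= F n' + G n'.
    have -> : (k.+1 * m = n' + (m - i))%N.
      by rewrite {1}n'E -addnA subnKC ?(ltnW im)// mulSn addnC.
    by apply: FG; rewrite leq_subr.
  have /ler_normlP[h2 _] := FS k.+1.
  have /ler_normlP[h3 _] := SE k.+1 (leqW kN).
  have h4 : G n' <= (n'%:R + 1) * e by exact: GE.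
  have {kw2}/kw2/ler_normlP[h5 _] : `|k.+1%:R * m%:R - n'%:R| <= m%:R :> R.
    by rewrite nk -natr1 ler_norml; lra.
  have h6 : k.+1%:R * e <= 2 * n'%:R * e.
    by rewrite ler_wpM2r// nk -natr1; nra.
  have h7 : k.+1%:R * (m%:R * e) <= 2 * n'%:R * e.
    by rewrite mulrA ler_wpM2r// nk -natr1; nra.
  have h8 : e <= n'%:R * e by rewrite ler_peMl// ler1n.
  by move: h2 h3 h4 h5; lra.
rewrite ler_norml; apply/andP; split.
  by rewrite lerBrDr addrC -ler_pdivrMl// ?invr_gt0 ?invrK// mulrDr mulrN; lra.
by rewrite lerBlDr mulrC ler_pdivrMr// mulrDl; lra.
Qed.

(** An instance of the interpolation with [S k] equal to k a_m and [G] constant: subadditivity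
    bounds a_(km) above by k a_m, and the lower bound [l] on all means makes the gap small. *)
Lemma fekete (R : realType) (a : nat -> R) (l : R) :
  a 0%N = 0 -> (forall n, 0 <= a n) -> (forall n m, a (n + m)%N <= a n + a m) ->
  (forall n, l <= n.+1%:R^-1 * a n.+1) ->
  (forall e, 0 < e -> exists2 m, (0 < m)%N & a m <= m%:R * (l + e)) ->
  n.+1%:R^-1 * a n.+1 @[n --> \oo] --> l.
Proof.
move=> a00 a0 aD la al; apply/cvgrPdist_le => e e0.
(* Seven eighths are spent by the interpolation, one eighth by the distance from [l] to a_m / m. *)
have e8 : 0 < e / 8 by rewrite divr_gt0.
have [m m0 am] := al _ e8.
have mR : 0 < m%:R :> R by rewrite ltr0n.
have al' n : n%:R * l <= a n.
  by case: n => [|n]; rewrite ?a00 ?mul0r// -ler_pdivlMl.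
have akm k : a (k * m)%N <= k%:R * a m.
  elim: k => [|k IH]; first by rewrite mul0r mul0n a00.
  by rewrite mulSn (le_trans (aD _ _))// -natr1 mulrDl mul1r; lra.
have H := @cvg_interpolation _ m (e / 8) (a m) a (fun k => k%:R * a m)
  (fun=> \sum_(i < m.+1) a i) m0 e8.
apply: filterS (H _ _ _ _) => [n nH|k|n i im||].
- have lm : `|l - a m / m%:R| <= e / 8.
    have q1 : l <= a m / m%:R by rewrite ler_pdivlMr// mulrC al'.
    have q2 : a m / m%:R <= l + e / 8 by rewrite ler_pdivrMr// mulrC.
    by rewrite ler_norml; lra.
  by rewrite (le_trans (ler_distD (a m / m%:R) _ _))// [X in _ + X]distrC; lra.
- rewrite distrC ger0_norm ?subr_ge0//.
  have q1 := al' (k * m)%N; rewrite natrM -mulrA in q1.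
  have : k%:R * a m <= k%:R * (m%:R * (l + e / 8)) by rewrite ler_wpM2l.
  by move: q1; rewrite !mulrDr; lra.
- rewrite (le_trans (aD _ _))// lerD2l (bigD1 (Ordinal (im : i < m.+1)%N))//= lerDl.
  exact: sumr_ge0.
- apply: nearW => k; rewrite mulKf// subrr normr0 ltW//.
- rewrite -[X in _ --> X](mul0r (\sum_(i < m.+1) a i)).
  by apply: cvgMl; exact: cvg_harmonic.
Qed.

(** * Weak-type estimates *)

Section ae_small.
Context d (X : measurableType d) (R : realType) (mu : probability X R).
Local Notation L1 := (Lfun mu 1%E).
Local Notation Int f := (Rintegral mu setT f).

(** Weak-type inequalities give conclusions off a set of small positive measure. As [Q] does not
    depend on that measure, it can fail only on the intersection of such sets, up to a null set. *)
Lemma ae_of_small (Q : X -> Prop) :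
  (forall e : R, 0 < e -> exists E, [/\ measurable E, (mu E <= e%:E)%E &
    \forall x \ae mu, ~ E x -> Q x]) ->
  \forall x \ae mu, Q x.
Proof.
move=> HQ; have {}HQ k : {E | [/\ measurable E, (mu E <= (harmonic k : R)%:E)%E &
    \forall x \ae mu, ~ E x -> Q x]}.
  by apply: cid; apply: HQ; rewrite harmonic_gt0.
pose E k := sval (HQ k).
have mE k : measurable (E k) by have [] := svalP (HQ k).
have Ek k : (mu (E k) <= (harmonic k : R)%:E)%E by have [] := svalP (HQ k).
have EQ : \forall x \ae mu, forall k, ~ E k x -> Q x.
  by apply: ae_foralln => k; have [] := svalP (HQ k).
have mN : measurable (\bigcap_k E k) by exact: bigcap_measurable.
have N0 : mu (\bigcap_k E k) = 0%E.
  apply/le_anti/andP; split; last exact: measure_ge0.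
  apply/lee_addgt0Pr => e e0; rewrite add0e.
  have [k _ /(_ k (leqnn k)) ke] := near_infty_natSinv_lt (PosNum e0).
  apply: (@le_trans _ _ (mu (E k))); last first.
    by apply: le_trans (Ek k) _; rewrite lee_fin ltW.
  by apply: le_measure; rewrite ?inE//; exact: bigcap_inf.
have : \forall x \ae mu, ~ (\bigcap_k E k) x.
  by exists (\bigcap_k E k); split=> // x /= /contrapT.
apply: filterS2 EQ => x Qx /= /existsNP[k] /not_implyP[_ nE].
exact: (Qx k).
Qed.

Lemma Int_truncation h (e : R) : h \in L1 -> (\forall x \ae mu, 0 <= h x) -> 0 < e ->
  exists2 K : R, 0 <= K & Int (h - (h \min cst K)) <= e.
Proof.
move=> Lh h0 e0.
have Lm K : h \min cst K \in L1 by apply: L1_min => //; exact: L1_cst.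
have [|||||_] := @dominated_cvg_Int _ _ _ mu (fun n => h - (h \min cst n%:R)) (cst (0 : R)) h => //.
- by move=> n; exact: L1_measurable (L1B Lh (Lm n%:R)).
- move=> n; apply: filterS h0 => x hx; rewrite !fctE/= ger0_norm ?subr_ge0 ?ge_min ?lexx//.
  by rewrite gerBl le_min hx ler0n.
- apply: aeW => x; apply: cvg_near_cst; exists (Num.bound `|h x|) => // n /= nN.
  by rewrite !fctE/= min_l ?subrr// le_natr_bound.
rewrite Int_cst => /cvgrPdist_le /(_ e e0)[n _ /(_ n (leqnn n))].
rewrite sub0r normrN => /(le_trans (ler_norm _)) In.
by exists n%:R.
Qed.

Variable P : (X -> R) -> X -> R.
Hypothesis PM : markov_operator mu P.

Lemma superadditive_weak_maximal (psi : nat -> X -> R) (s l : R) :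
  (forall n, psi n \in L1) -> (forall n, \forall x \ae mu, 0 <= psi n x) ->
  superadditive mu P psi -> (forall n, Int (psi n) <= n%:R * s) ->
  P \1_[set: X] = \1_[set: X] %[ae mu] -> 0 < l ->
  exists E, [/\ measurable E, (mu E <= (s / l)%:E)%E &
    forall x n, ~ E x -> (0 < n)%N -> psi n x <= n%:R * l].
Proof.
move=> Lpsi psi0 psiS Ipsi P1 l0.
have LC := L1_cst mu l.
have C0 : \forall x \ae mu, 0 <= (cst l : X -> R) x by apply: aeW => x; exact: ltW.
have PC : \forall x \ae mu, P (cst l) x <= l by apply: filterS (markov_cst PM P1 l) => x ->.
have := superadditive_maximal PM Lpsi psi0 psiS Ipsi LC C0 PC.
set E := [set x | _] => IE; exists E.
have mE : measurable E.
  apply: measurable_exists_le => // n; exact: L1_measurable (Lpsi n).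
split=> //; last first.
  by move=> x n nE n0; rewrite leNgt; apply/negP => /ltW H; apply: nE; exists n.
have : l * Int (\1_E) <= s by rewrite -(IntZ _ (L1_indic mu mE)).
rewrite mulrC -ler_pdivlMr// -lee_fin -IntE ?L1_indic// integral_indic//.
by rewrite setIT.
Qed.

Hypothesis P1 : P \1_[set: X] = \1_[set: X] %[ae mu].

(** An iterate of a nonnegative function is at most the Birkhoff sum that ends with it, so the
    weak-type inequality controls the part of [h] above a level [K]; the part below contributes at
    most K / (n + 1). This disposes of the remainders in the interpolation. *)
Lemma iter_markov_small h : h \in L1 -> (\forall x \ae mu, 0 <= h x) ->
  \forall x \ae mu, n.+1%:R^-1 * iter n P h x @[n --> \oo] --> (0 : R).
Proof.
move=> Lh h0.
have it0 : \forall x \ae mu, forall n, 0 <= iter n P h x.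
  by apply: ae_foralln => n; exact: (markov_ge0 (markov_iter PM n)).
suff : \forall x \ae mu, forall k, \forall n \near \oo,
    n.+1%:R^-1 * iter n P h x <= k.+1%:R^-1.
  apply: filterS2 it0 => x itx H; apply/cvgrPdist_le => e e0.
  have [k _ /(_ k (leqnn k)) ke] := near_infty_natSinv_lt (PosNum e0).
  apply: filterS (H k) => n Hn; rewrite sub0r normrN ger0_norm ?mulr_ge0//.
  by rewrite (le_trans Hn)// ltW.
apply: ae_foralln => k; set e := k.+1%:R^-1.
have e0 : 0 < e / 2 :> R by rewrite divr_gt0 ?invr_gt0.
apply: ae_of_small => q q0.
(* The weak-type inequality divides this integral by the level [e / 2], leaving an exceptional set
   of measure at most [q]. *)
have [K K0 IK] := Int_truncation Lh h0 (mulr_gt0 q0 e0).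
pose b := h \min cst K; pose r := h - b.
have LK := L1_cst mu K.
have Lb : b \in L1 by exact: L1_min.
have Lr : r \in L1 by exact: rpredB.
have r0 : \forall x \ae mu, 0 <= r x.
  by apply: aeW => x; rewrite /r !fctE subr_ge0 ge_min lexx.
have Ir n : Int (birkhoff P r n) <= n%:R * Int r by rewrite (Int_birkhoff PM).
have [E [mE muE HE]] := superadditive_weak_maximal (fun n => L1_birkhoff PM n Lr)
  (fun n => birkhoff_ge0 PM n Lr r0) (birkhoff_superadditive PM Lr) Ir P1 e0.
exists E; split=> //.
  by apply: le_trans muE _; rewrite lee_fin ler_pdivrMr.
have itB : \forall x \ae mu, forall n, iter n P h x <= K + iter n P r x.
  apply: ae_foralln => n.
  have bK : \forall x \ae mu, b x <= K by apply: aeW => x; rewrite /b/= ge_min lexx orbT.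
  have := markovD (markov_iter PM n) Lb Lr; rewrite {1}/r addrC subrK.
  apply: filterS3 (markov_le (markov_iter PM n) Lb LK bK)
    (markov_cst (markov_iter PM n) (markov_iter1 PM P1 n) K) => x h1 h2 ->.
  by rewrite -[in leRHS]h2 lerD2r.
have itr : \forall x \ae mu, forall n, 0 <= iter n P r x.
  by apply: ae_foralln => n; exact: (markov_ge0 (markov_iter PM n)).
apply: filterS2 itB itr => x itBx itrx nE.
exists (Num.bound (K / (e / 2))) => // n /= nK.
rewrite mulrC ler_pdivrMr//.
have h1 : iter n P r x <= n.+1%:R * (e / 2).
  apply: le_trans (HE x n.+1 nE _) => //.
  by rewrite birkhoffE big_ord_recr/= lerDr sumr_ge0.
have h2 : K <= n.+1%:R * (e / 2).
  rewrite -ler_pdivrMr//; apply: ltW.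
  apply: (lt_le_trans (archi_boundP (divr_ge0 K0 (ltW e0)))).
  by rewrite ler_nat leqW.
by apply: le_trans (itBx n) _; lra.
Qed.

End ae_small.

(** * Nonnegative subadditive sequences *)

Section kingman_nonneg.
Context d (X : measurableType d) (R : realType) (mu : probability X R).
Variable P : (X -> R) -> X -> R.
Hypothesis PM : markov_operator mu P.
Hypothesis P1 : P \1_[set: X] = \1_[set: X] %[ae mu].

Local Notation L1 := (Lfun mu 1%E).
Local Notation Int f := (Rintegral mu setT f).

Lemma superadditive_limit_invariant (psi : nat -> X -> R) (s : R) (g : X -> R) :
  (forall n, psi n \in L1) -> (forall n, \forall x \ae mu, 0 <= psi n x) ->
  superadditive mu P psi -> (forall n, Int (psi n) <= n%:R * s) ->
  g \in L1 ->
  (\forall x \ae mu, n.+1%:R^-1 * psi n.+1 x @[n --> \oo] --> g x) ->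
  \forall x \ae mu, P g x = g x.
Proof.
move=> Lpsi psi0 psiS Ipsi Lg psig.
have [w [Lw _ Pw wE]] := superadditive_liminf PM Lpsi psi0 psiS Ipsi.
have wg : \forall x \ae mu, w x = g x.
  apply: filterS2 wE psig => x wx gx; apply: EFin_inj; rewrite wx.
  apply: (cvg_limn_einf_sup _).1.
  by apply/cvg_EFin => //; exact: nearW.
by apply: filterS3 wg (markov_eq PM Lw Lg wg) Pw => x <- <-.
Qed.

Definition markov_subadditive (f : nat -> X -> R) :=
  forall n m, \forall x \ae mu, f (n + m)%N x <= f n x + iter n P (f m) x.

Section sequence.
Variable f : nat -> X -> R.
Hypothesis Lf : forall n, f n \in L1.
Hypothesis f0 : f 0%N = 0.
Hypothesis fge0 : forall n, \forall x \ae mu, 0 <= f n x.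
Hypothesis fS : markov_subadditive f.

Let L := inf (range (fun n => n.+1%:R^-1 * Int (f n.+1))).

Let Int_f_ge0 n : 0 <= Int (f n).
Proof. exact: Int_ge0. Qed.

Let has_inf_mean : has_inf (range (fun n => n.+1%:R^-1 * Int (f n.+1))).
Proof.
split; first by exists (1%:R^-1 * Int (f 1)); exists 0%N.
by exists 0 => _ [n _ <-]; rewrite mulr_ge0.
Qed.

Let L_le n : n%:R * L <= Int (f n).
Proof.
case: n => [|n]; first by rewrite mul0r.
rewrite -ler_pdivlMl//; apply: ge_inf; first exact: has_inf_mean.2.
by exists n.
Qed.

Let L_adherent (e : R) : 0 < e -> exists2 m, (0 < m)%N & Int (f m) <= m%:R * (L + e).
Proof.
move=> e0; have [_ [n _ <-] nL] := inf_adherent e0 has_inf_mean.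
by exists n.+1 => //; rewrite -ler_pdivrMl// ltW.
Qed.

Lemma markov_subadditive_le_birkhoff m k :
  \forall x \ae mu, f (k * m)%N x <= birkhoff (iter m P) (f m) k x.
Proof.
elim: k => [|k IH]; first by apply: aeW => x; rewrite mul0n f0 birkhoffE big_ord0.
rewrite mulSn addnC; apply: filterS2 IH (fS (k * m) m) => x IH /le_trans; apply.
rewrite birkhoffE big_ord_recr/= -birkhoffE -iterM lerD2r.
exact: IH.
Qed.

(* [S k] is the Birkhoff sum of the bounded part of [f m] under [P^m]; [D k]
   collects the two errors S_k r and S_k (f m) - f (k m). *)
Let approx (e : R) : 0 < e -> exists m w S D,
  [/\ (0 < m)%N, w \in L1, `|Int w - m%:R * L| <= m%:R * e &
    \forall x \ae mu, n.+1%:R^-1 * S n.+1 x @[n --> \oo] --> w x] /\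
  [/\ forall n, S n \in L1, forall n, D n \in L1,
    forall n, \forall x \ae mu, 0 <= D n x &
    [/\ superadditive mu (iter m P) D,
        forall n, Int (D n) <= n%:R * (2 * (m%:R * e)) &
        forall k, \forall x \ae mu, `|f (k * m)%N x - S k x| <= D k x]].
Proof.
move=> e0; have [m m0 fm] := L_adherent e0.
have me0 : 0 < m%:R * e by rewrite mulr_gt0// ltr0n.
have [K K0 IK] := Int_truncation (Lf m) (fge0 m) me0.
pose Q := iter m P.
have QM : markov_operator mu Q := markov_iter PM m.
have Q1 : Q \1_[set: X] = \1_[set: X] %[ae mu] := markov_iter1 PM P1 m.
pose b := f m \min cst K; pose r := f m - b.
have Lb : b \in L1 by apply: L1_min => //; exact: L1_cst.
have Lr : r \in L1 by exact: L1B.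
have r0 : \forall x \ae mu, 0 <= r x.
  by apply: aeW => x; rewrite /r !fctE subr_ge0 ge_min lexx.
have bK : \forall x \ae mu, 0 <= b x <= K.
  by apply: filterS (fge0 m) => x fx; rewrite /b/= le_min fx K0 ge_min lexx orbT.
have [w [Lw Iw Sw]] := ergodic_bounded QM Q1 Lb bK.
pose F k : X -> R := birkhoff Q (f m) k - f (k * m)%N.
pose S := birkhoff Q b.
pose D k : X -> R := birkhoff Q r k + F k.
have LB h k : h \in L1 -> birkhoff Q h k \in L1 by move=> Lh; exact: (L1_birkhoff QM).
have LF k : F k \in L1 by apply: L1B => //; exact: LB.
have F0 k : \forall x \ae mu, 0 <= F k x.
  by apply: filterS (markov_subadditive_le_birkhoff m k) => x; rewrite /F !fctE subr_ge0.
have IbE : Int r = Int (f m) - Int b by rewrite IntB.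
exists m, w, S, D; split; split=> //.
- rewrite Iw; move: IK; rewrite -/b -/r IbE => IK.
  have := Int_ge0 Lr r0; rewrite IbE.
  by have := L_le m; rewrite ler_norml; move: fm; rewrite mulrDr; lra.
- by move=> k; exact: LB.
- by move=> k; apply: L1D => //; exact: LB.
- move=> k; apply: filterS2 (F0 k) (birkhoff_ge0 QM k Lr r0) => x Fx rx.
  by rewrite /D !fctE addr_ge0.
split.
- move=> n k.
  have h1 := markovD (markov_iter QM n) (LB _ k Lr) (LF k).
  have h2 := markovB (markov_iter QM n) (LB _ k (Lf m)) (Lf (k * m)%N).
  have h3 := birkhoff_additive QM n k Lr.
  have h4 := birkhoff_additive QM n k (Lf m).
  have h5 := fS (n * m)%N (k * m)%N; rewrite -mulnDl in h5.
  apply: filterS3 (filterI h1 h2) (filterI h3 h4) h5 => x [e1 e2] [e3 e4].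
  rewrite /D !fctE e1 -e3 /F !fctE -/(F k) e2 -e4 iterM.
  by rewrite -/Q; lra.
(* One term m e bounds [Int r]. The other bounds Int f_m - m L, because Int f_(nm) is at least n m
   L. *)
- move=> n; rewrite IntD ?IntB//; try exact: LB.
  rewrite !(Int_birkhoff QM)// IbE.
  have := L_le (n * m)%N; rewrite natrM -mulrA => h1.
  have h2 : n%:R * Int (f m) <= n%:R * (m%:R * (L + e)) by rewrite ler_wpM2l.
  have h3 : n%:R * (Int (f m) - Int b) <= n%:R * (m%:R * e).
    by rewrite ler_wpM2l// -IbE.
  move: h1 h2 h3; rewrite !mulrDr; lra.
- move=> k; have := birkhoffB QM k (Lf m) Lb; rewrite -/r.
  apply: filterS3 (F0 k) (birkhoff_ge0 QM k Lr r0) => x Fx rx rE.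
  move: rx Fx; rewrite /D /F !fctE rE /S ler_norml; lra.
Qed.

(** A single integrable function dominates all remainders of length at most [m], so
    [iter_markov_small] is needed for that function alone. *)
Let f_le_tail m : \forall x \ae mu, forall n i, (i <= m)%N ->
  f (n + i)%N x <= f n x + iter n P (\sum_(i < m.+1) f i) x.
Proof.
apply: ae_foralln => n; apply: ae_foralln => i.
have [im|im] := leqP i m; last exact: aeW.
have Ls : \sum_(i < m.+1) f i \in L1 by exact: L1_sum.
have fi : \forall x \ae mu, f i x <= (\sum_(i < m.+1) f i) x.
  apply: filterS (ae_foralln fge0) => x fx; rewrite fct_sumE.
  by rewrite (bigD1 (Ordinal (im : i < m.+1)%N))//= lerDl sumr_ge0.
apply: filterS2 (fS n i) (markov_le (markov_iter PM n) (Lf i) Ls fi) => x h1 h2 _.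
by rewrite (le_trans h1)// lerD2l.
Qed.

Lemma kingman_nonneg_is_cvg :
  \forall x \ae mu, cvgn (fun n => n.+1%:R^-1 * f n.+1 x).
Proof.
(* The approximate limit [l] may depend on the accuracy: the Cauchy criterion needs no common
   candidate. *)
suff H : \forall x \ae mu, forall k : nat, exists l,
    \forall n \near \oo, `|n.+1%:R^-1 * f n.+1 x - l| <= 7 * harmonic k.
  apply: filterS H => x Hx; apply: cauchy_cvg; apply: cauchy_exP => e e0.
  have e8 : 0 < e / 8 by rewrite divr_gt0.
  have [k _ /(_ k (leqnn k)) ke] := near_infty_natSinv_lt (PosNum e8).
  have [l Hl] := Hx k; exists l; apply: filterS Hl => n Hn.
  rewrite /ball/= distrC (le_lt_trans Hn)//.
  by have : harmonic k < e / 8 := ke; lra.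
apply: ae_foralln => k; set e := harmonic k.
have e0 : 0 < e by exact: harmonic_gt0.
apply: (@ae_of_small _ _ _ mu) => q q0.
(* With this accuracy the mean of [D] is at most q m e; at the level m e that the interpolation
   tolerates, the exceptional set has measure at most [q]. *)
have eq0 : 0 < q * e / 2 by rewrite divr_gt0// mulr_gt0.
have [m [w [S [D [[m0 Lw Iw Sw] [LS LD D0 [DS ID fSD]]]]]]] := approx eq0.
have mR : 0 < m%:R :> R by rewrite ltr0n.
have [E [mE muE HE]] := superadditive_weak_maximal (markov_iter PM m) LD D0 DS ID
  (markov_iter1 PM P1 m) (mulr_gt0 mR e0).
exists E; split=> //.
  apply: le_trans muE _; rewrite lee_fin ler_pdivrMr ?mulr_gt0//.
  by rewrite le_eqVlt; apply/orP; left; apply/eqP; field.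
(* The maximal bound concerns positive indices, whereas the interpolation also asks for index 0;
   there superadditivity forces [D 0 <= 0]. *)
have D00 : \forall x \ae mu, D 0%N x <= 0.
  by apply: filterS (DS 0%N 0%N) => x /=; rewrite gerDl.
have Ls : \sum_(i < m.+1) f i \in L1 by exact: L1_sum.
have s0 : \forall x \ae mu, 0 <= (\sum_(i < m.+1) f i) x.
  by apply: filterS (ae_foralln fge0) => x fx; rewrite fct_sumE sumr_ge0.
apply: filterS3 (filterI D00 (ae_foralln fSD)) (filterI Sw (f_le_tail m))
  (iter_markov_small PM P1 Ls s0) => x [D0x Dx] [Sx tx] Gx nE.
exists (w x / m%:R).
apply: (@cvg_interpolation _ m e (w x) (fun n => f n x) (fun n => S n x)
  (fun n => iter n P (\sum_(i < m.+1) f i) x)) => //.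
- move=> [|j]; first by apply: le_trans (Dx 0%N) _; rewrite mul0r.
  by apply: le_trans (Dx _) _; exact: HE.
- move/cvgrPdist_le : Sx => /(_ e e0); apply: filterS => n.
  by rewrite distrC.
Qed.

(** Fatou makes the limit integrable but only gives Int g <= L. For equality, m g - w is the limit
    of (f_(km) - S_k) / k, whose L^1 norms are at most 2 m e; combined with |Int w - m L| <= m e
    this yields |Int g - L| <= 3 e. *)
Lemma kingman_nonneg : exists g : X -> R, [/\ g \in L1,
  \forall x \ae mu, n.+1%:R^-1 * f n.+1 x @[n --> \oo] --> g x,
  n.+1%:R^-1 * Int (f n.+1) @[n --> \oo] --> Int g &
  forall n, Int g <= n.+1%:R^-1 * Int (f n.+1)].
Proof.
have If n : n%:R * L <= Int (f n) by exact: L_le.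
have cI : n.+1%:R^-1 * Int (f n.+1) @[n --> \oo] --> L.
  apply: (@fekete _ (fun n => Int (f n))) => //.
  - by rewrite f0 (Int_cst mu 0).
  - move=> n m; have Lit := markov_L1 (markov_iter PM n) (Lf m).
    rewrite -(markov_Int (markov_iter PM n) (Lf m)) -IntD//.
    apply: (le_Int (Lf _) (L1D (Lf n) Lit)); exact: fS.
  - by move=> n; rewrite ler_pdivlMl.
pose a n : X -> R := n.+1%:R^-1 *: f n.+1.
have La n : a n \in L1 by exact: L1Z.
have a0 n : \forall x \ae mu, 0 <= a n x.
  by apply: filterS (fge0 n.+1) => x fx; rewrite /a !fctE mulr_ge0.
have Ia n : Int (a n) <= n.+1%:R^-1 * Int (f n.+1) by rewrite IntZ.
have [g [Lg g0 _ gE]] := fatou_Int La a0 Ia cI.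
have ag : \forall x \ae mu, n.+1%:R^-1 * f n.+1 x @[n --> \oo] --> g x.
  apply: filterS2 gE kingman_nonneg_is_cvg => x gx /cvg_ex[l al].
  suff -> : g x = l by [].
  apply: EFin_inj; rewrite gx; apply: (cvg_limn_einf_sup _).1.
  by apply/cvg_EFin => //; exact: nearW.
suff IgL : Int g = L.
  by exists g; split=> //; rewrite IgL// => n; rewrite ler_pdivlMl.
suff IgL (e : R) : 0 < e -> `|Int g - L| <= 3 * e.
  apply/eqP; rewrite -subr_eq0 -normr_le0; apply/ler_addgt0Pr => e e0.
  have e3 : 0 < e / 3 by rewrite divr_gt0.
  by have := IgL _ e3; lra.
move=> e0; have [m [w [S [D [[m0 Lw Iw Sw] [LS LD D0 [DS ID fSD]]]]]]] := approx e0.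
have mR : 0 < m%:R :> R by rewrite ltr0n.
pose U k : X -> R := k.+1%:R^-1 *: (Num.norm \o (f (k.+1 * m)%N - S k.+1)).
have LN k : Num.norm \o (f (k.+1 * m)%N - S k.+1) \in L1.
  by apply: Lfun_norm; exact: L1B.
have LU k : U k \in L1 by exact: L1Z.
have U0 k : \forall x \ae mu, 0 <= U k x.
  by apply: aeW => x; rewrite /U !fctE mulr_ge0.
have IU k : Int (U k) <= 2 * (m%:R * e).
  rewrite IntZ// ler_pdivrMl//; apply: le_trans (ID _).
  exact: (le_Int (LN k) (LD _) (fSD _)).
have [z [Lz _ Iz zE]] := fatou_Int LU U0 IU (cvg_cst _).
have mg : m%:R *: g \in L1 by exact: L1Z.
have zg : \forall x \ae mu, z x = `|(m%:R *: g - w) x|.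
  apply: filterS3 zE ag Sw => x zx agx Swx.
  apply: EFin_inj; rewrite zx; apply: (cvg_limn_einf_sup _).1.
  apply/cvg_EFin; first exact: nearW.
  (* The averages are indexed from [n.+1], so the multiple [k.+1 * m] is reached at its
     predecessor. *)
  have sub : (k.+1 * m).-1 @[k --> \oo] --> \oo.
    move=> A [N _ NA]; exists N => // k /= Nk; apply: NA => /=.
    by rewrite -ltnS prednK ?muln_gt0// (leq_trans _ (leq_pmulr _ m0)).
  have {}agx := cvg_comp _ _ sub agx.
  have agS : m%:R * ((k.+1 * m).-1.+1%:R^-1 * f (k.+1 * m).-1.+1 x)
      - k.+1%:R^-1 * S k.+1 x @[k --> \oo] --> m%:R * g x - w x.
    by apply: cvgB Swx; apply: cvgM agx; exact: cvg_cst.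
  rewrite (_ : fine \o _ = fun k => `|m%:R * ((k.+1 * m).-1.+1%:R^-1 *
      f (k.+1 * m).-1.+1 x) - k.+1%:R^-1 * S k.+1 x|); first exact: cvg_norm agS.
  apply/funext => k; rewrite /U /= !fctE prednK ?muln_gt0//= -[_ *: _]/(_ * _).
  rewrite -{1}(gtr0_norm (_ : 0 < k.+1%:R^-1)) ?invr_gt0// -normrM mulrBr natrM.
  by congr (`| _ - _ |); rewrite mulrA; congr (_ * _); field; rewrite ?lt0r_neq0.
have Iz' : `|m%:R * Int g - Int w| <= Int z.
  rewrite -IntZ// -IntB//.
  rewrite (@Int_ae_eq _ _ _ mu z (Num.norm \o (m%:R *: g - w)))//; last first.
    by apply: Lfun_norm; exact: L1B.
  apply: le_normr_Rintegral => //; apply/Lfun1_integrable; exact: L1B.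
have mIg : `|m%:R * (Int g - L)| <= m%:R * (3 * e).
  rewrite mulrBr (le_trans (ler_distD (Int w) _ _))//.
  by apply: (@le_trans _ _ (2 * (m%:R * e) + m%:R * e)); [apply: lerD => //; exact: le_trans Iz|lra].
by move: mIg; rewrite normrM (gtr0_norm mR) ler_pM2l.
Qed.

End sequence.

(** Invariance of lower limits is known for superadditive sequences, and [f] is subadditive. It is
    the difference of the Birkhoff sums [S] of [f 1] and of [D = S - f]; both are nonnegative and
    superadditive, so both limits are invariant. *)
Lemma kingman_nonneg_invariant (f : nat -> X -> R) (g : X -> R) :
  (forall n, f n \in L1) -> f 0%N = 0 -> (forall n, \forall x \ae mu, 0 <= f n x) ->
  markov_subadditive f -> g \in L1 ->
  (\forall x \ae mu, n.+1%:R^-1 * f n.+1 x @[n --> \oo] --> g x) ->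
  \forall x \ae mu, P g x = g x.
Proof.
move=> Lf f0 fge0 fS Lg fg.
pose S := birkhoff P (f 1).
have LS n : S n \in L1 by exact: (L1_birkhoff PM).
have Sge0 n : \forall x \ae mu, 0 <= S n x by exact: (birkhoff_ge0 PM).
have Sadd n m : \forall x \ae mu, S n x + iter n P (S m) x = S (n + m)%N x.
  exact: (birkhoff_additive PM).
have IS n : Int (S n) <= n%:R * Int (f 1) by rewrite (Int_birkhoff PM).
have S0 : S 0%N = 0 by rewrite /S /birkhoff big_ord0.
have SS : markov_subadditive S by move=> n m; apply: filterS (Sadd n m) => x ->.
(* An additive sequence is subadditive, so the Birkhoff averages of [f 1], possibly unbounded,
   converge by the result just proved. *)
have [h [Lh Sh _ _]] := kingman_nonneg LS S0 Sge0 SS.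
have Ph : \forall x \ae mu, P h x = h x.
  exact: (superadditive_limit_invariant LS Sge0 (birkhoff_superadditive PM (Lf 1)) IS Lh Sh).
pose D n : X -> R := S n - f n.
have LD n : D n \in L1 by exact: L1B.
have D0 n : \forall x \ae mu, 0 <= D n x.
  have := markov_subadditive_le_birkhoff f0 fS 1 n; rewrite muln1.
  by apply: filterS => x; rewrite /D !fctE subr_ge0.
have DS : superadditive mu P D.
  move=> n m; have := markovB (markov_iter PM n) (LS m) (Lf m).
  apply: filterS3 (Sadd n m) (fS n m) => x e1 h1 e2.
  rewrite -[leLHS]/(S n x - f n x + iter n P (S m - f m) x).
  by rewrite -[leRHS]/(S (n + m)%N x - f (n + m)%N x) e2 -e1; lra.
have ID n : Int (D n) <= n%:R * Int (f 1).
  rewrite IntB// (le_trans _ (IS n))// gerBl; exact: Int_ge0.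
have Lhg : h - g \in L1 by exact: L1B.
have Dhg : \forall x \ae mu, n.+1%:R^-1 * D n.+1 x @[n --> \oo] --> (h - g) x.
  apply: filterS2 Sh fg => x hx gx.
  rewrite (_ : (fun n => _) = fun n => n.+1%:R^-1 * S n.+1 x - n.+1%:R^-1 * f n.+1 x).
    exact: cvgB.
  by apply/funext => n; rewrite -mulrBr.
have Phg := superadditive_limit_invariant LD D0 DS ID Lhg Dhg.
apply: filterS3 Ph Phg (markovB PM Lh Lg) => x e1 e2; rewrite e2 !fctE e1; lra.
Qed.

End kingman_nonneg.

(** * Truncation of extended real functions *)

Lemma le_limn_esup_cvg (R : realType) (a b : nat -> \bar R) (l : \bar R) :
  (forall k, (a k <= b k)%E) -> b k @[k --> \oo] --> l -> (limn_esup a <= l)%E.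
Proof.
move=> ab bl; rewrite -(cvg_limn_einf_sup bl).2 !limn_esup_lim.
apply: lee_lim; [exact: is_cvg_esups|exact: is_cvg_esups|].
apply: nearW => n; apply: ge_ereal_sup => _ [k /= nk <-]; apply: (le_trans (ab k)).
by apply: ereal_sup_ubound; exists k.
Qed.

Lemma cvg_maxe_cst (R : realType) (l : \bar R) :
  (l != +oo)%E -> maxe l (- k%:R)%:E @[k --> \oo] --> l.
Proof.
case: l => [r| |] // _.
  apply: cvg_near_cst; exists (Num.bound `|r|) => // k /= rk.
  by rewrite max_l// lee_fin ge_Nnatr_bound.
apply/cvgeNyPle => A; exists (Num.bound `|A|) => // k /= Ak.
by rewrite ge_max leNye/= lee_fin ge_Nnatr_bound.
Qed.

(** If some limit lies above its floor [- K], that truncation is eventually inactive and [a] has the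
    same limit. Otherwise every limit equals its floor, and [a] tends to [-oo]. *)
Lemma cvg_of_truncations (R : realType) (a : nat -> \bar R) (h : nat -> R) :
  (forall K, maxe (a n) (- K%:R)%:E @[n --> \oo] --> (h K)%:E) ->
  exists l, [/\ (l != +oo)%E, a n @[n --> \oo] --> l &
    forall K, maxe l (- K%:R)%:E = (h K)%:E].
Proof.
move=> ah.
have hK K : - K%:R <= h K.
  rewrite -lee_fin -(cvg_lim _ (ah K))//; apply: lime_ge.
    by apply/cvg_ex; exists (h K)%:E.
  by apply: nearW => n; rewrite le_max lexx orbT.
have [[K0 K0h]|nK] := pselect (exists K, - K%:R < h K).
  have al : a n @[n --> \oo] --> (h K0)%:E.
    apply: cvg_trans (ah K0); apply: near_eq_cvg.
    have : \forall n \near \oo, ((- K0%:R)%:E < maxe (a n) (- K0%:R)%:E)%E.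
      have [fin_a] := (fine_cvgP _ _).1 (ah K0).
      move=> /cvgrPdist_lt/(_ (h K0 + K0%:R)); rewrite -ltrBlDr sub0r => /(_ K0h).
      apply: filterS2 fin_a => n fa; rewrite ltr_distlC => /andP[+ _].
      rewrite opprD addNKr -lte_fin /= fineK//.
    by apply: filterS => n; rewrite lt_max ltxx orbF => /ltW/max_l.
  exists (h K0)%:E; split => // K.
  have [fin_a ar] := (fine_cvgP _ _).1 al.
  apply: (cvg_unique _ _ (ah K)) => //; rewrite -EFin_max.
  apply/fine_cvgP; split.
    by apply: filterS fin_a => n; case: (a n) => // r _; rewrite maxEle; case: ifP.
  have cm : {for (h K0 : R), continuous (id \max cst (- K%:R : R))}.
    by apply: continuous_max; [exact: cvg_id|exact: cvg_cst].
  apply: cvg_trans (cvg_comp _ _ ar cm); apply: near_eq_cvg.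
  apply: filterS fin_a => n /=; case: (a n) => // r _.
  by rewrite !maxEle lee_fin; case: ifP.
have hE K : h K = - K%:R.
  apply/le_anti; rewrite hK andbT leNgt; apply/negP => Kh.
  by apply: nK; exists K.
exists -oo%E; split=> //; last by move=> K; rewrite maxNye hE.
apply/cvgeNyPle => A; pose K := (Num.bound `|A|).+1.
have AK : - K%:R + 1 <= A.
  by rewrite -natr1 opprD subrK ge_Nnatr_bound.
have [fin_a] := (fine_cvgP _ _).1 (ah K).
move=> /cvgrPdist_lt/(_ 1 ltr01); apply: filterS2 fin_a => n fa.
rewrite ltr_distlC hE => /andP[_] aK.
have : (maxe (a n) (- K%:R)%:E <= A%:E)%E.
  by rewrite -(fineK fa) lee_fin (le_trans (ltW aK)).
by apply: le_trans; rewrite le_max lexx.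
Qed.

Section truncate_below.
Context d (X : measurableType d) (R : realType) (mu : probability X R).
Local Notation L1 := (Lfun mu 1%E).
Local Notation Int f := (Rintegral mu setT f).
Local Notation tr := truncate_below.

Lemma integrable_fine_L1 (h : X -> \bar R) : mu.-integrable setT h ->
  fine \o h \in L1 /\ \forall x \ae mu, h x = (fine (h x))%:E.
Proof.
move=> ih; have mh := measurable_int _ ih.
have hE : \forall x \ae mu, h x = (fine (h x))%:E.
  by apply: filterS (integrable_ae measurableT ih) => x /(_ I)/fineK ->.
have mf : measurable_fun setT (fine \o h).
  by apply: measurableT_comp => //; exact: fine_measurable.
split=> //; apply/Lfun1_integrable/integrableP; split; first exact/measurable_EFinP.
move/integrableP : ih => [_]; apply: le_lt_trans.
apply: ae_ge0_le_integral => //.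
- by apply: measurableT_comp => //; exact/measurable_EFinP.
- exact: measurableT_comp.
- by apply: filterS hE => x /= hx _; rewrite [in leRHS]hx.
Qed.

Implicit Types (phi : X -> \bar R) (u : X -> R).

Lemma truncate_belowE phi k x : (phi x != +oo)%E ->
  (tr phi k x)%:E = maxe (phi x) (- k%:R)%:E.
Proof.
by rewrite /tr; case: (phi x) => [r| |]//= _; rewrite ?maxNye// -EFin_max.
Qed.

Lemma truncate_below_ge phi k x : (phi x != +oo)%E -> (phi x <= (tr phi k x)%:E)%E.
Proof. by move=> px; rewrite truncate_belowE// le_max lexx. Qed.

Lemma truncate_below_geN phi k x : (phi x != +oo)%E -> - k%:R <= tr phi k x.
Proof. by move=> px; rewrite -lee_fin truncate_belowE// le_max lexx orbT. Qed.

Lemma truncate_below_le phi k l x : (phi x != +oo)%E -> (k <= l)%N ->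
  tr phi l x <= tr phi k x.
Proof.
move=> px kl; rewrite -lee_fin !truncate_belowE// ge_max !le_max lexx/=.
by rewrite lee_fin lerN2 ler_nat kl orbT.
Qed.

Definition dominated phi := exists2 u, u \in L1 &
  \forall x \ae mu, (phi x <= (u x)%:E)%E.

Lemma dominated_lty phi : dominated phi -> \forall x \ae mu, (phi x != +oo)%E.
Proof. by case=> u _; apply: filterS => x; case: (phi x). Qed.

Lemma L1_truncate_below phi k : measurable_fun setT phi -> dominated phi ->
  tr phi k \in L1.
Proof.
move=> mphi [u Lu phiu].
apply: (@L1_le _ _ _ mu _ ((Num.norm \o u) + cst k%:R)).
- apply: measurableT_comp; first exact: fine_measurable.
  by apply: measurable_maxe => //; exact: measurable_cst.
- by apply: L1D; [exact: Lfun_norm|exact: L1_cst].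
apply: filterS phiu => x pu; have px : (phi x != +oo)%E by case: (phi x) pu.
have h1 := truncate_below_geN k px.
have h2 : tr phi k x <= `|u x| + k%:R.
  have k0 : 0 <= k%:R :> R by [].
  have q1 : u x <= `|u x| + k%:R by have := ler_norm (u x); lra.
  have q2 : - k%:R <= `|u x| + k%:R by have := normr_ge0 (u x); lra.
  by rewrite -lee_fin truncate_belowE// ge_max (le_trans pu) !lee_fin.
rewrite !fctE /= ler_norml h2 andbT; apply: le_trans h1.
by rewrite lerN2 lerDr.
Qed.

Let truncated_negative_part phi k x : (phi x != +oo)%E ->
  (mine (phi^\- x) k%:R%:E = (tr phi 0 x - tr phi k x)%:E)%E.
Proof.
move=> px; rewrite EFinB !truncate_belowE// funenegE oppr0.
case: (phi x) px => [r| |]//= _; last first.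
  by rewrite maxye !maxNye min_r ?leey// -EFinB sub0r opprK.
rewrite -!EFin_max -EFin_min -EFinB; congr EFin.
have k0 : 0 <= k%:R :> R by [].
have [h1|h1] := leP 0 r.
  rewrite (max_r (_ : - r <= 0)) ?oppr_le0//.
  by rewrite min_l// max_l ?subrr// (le_trans _ h1)// oppr_le0.
rewrite (max_l (_ : 0 <= - r)) ?oppr_ge0 ?ltW//.
have [h2|h2] := leP r (- k%:R).
  by rewrite min_r ?sub0r ?opprK// lerNr.
by rewrite min_l ?sub0r// lerNl ltW.
Qed.

Lemma cvg_Int_truncate_below phi : measurable_fun setT phi -> dominated phi ->
  (Int (tr phi k))%:E @[k --> \oo] --> (\int[mu]_x phi x)%E.
Proof.
move=> mphi dphi; have Lt k := L1_truncate_below k mphi dphi.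
have phiy := dominated_lty dphi.
pose W (k : nat) x := mine (phi^\- x)%E (k%:R%:E : \bar R).
have mW k : measurable_fun setT (W k).
  by apply: measurable_mine => //; exact: measurable_funeneg.
have W0 k x : setT x -> (0 <= W k x)%E.
  by move=> _; rewrite /W le_min funeneg_ge0 lee_fin ler0n.
have Wh x : setT x -> {homo W^~ x : n m / (n <= m)%N >-> (n <= m)%E}.
  by move=> _ n m nm; rewrite /W le_min ge_min lexx/= ge_min lee_fin ler_nat nm orbT.
have IW k : (\int[mu]_x W k x = (Int (tr phi 0))%:E - (Int (tr phi k))%:E)%E.
  rewrite -EFinB -IntB// -IntE; last exact: L1B.
  apply: ae_eq_integral => //.
    by apply/measurable_EFinP; exact: L1_measurable (L1B (Lt 0%N) (Lt k)).
  by apply: filterS phiy => x px _; rewrite /W truncated_negative_part.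
have Wl x : limn (W^~ x) = (phi^\- x)%E.
  apply/cvg_lim => //; rewrite /W.
  have : (0 <= phi^\- x)%E by exact: funeneg_ge0.
  case: (phi^\- x)%E => [r| |]// _.
    apply: cvg_near_cst; exists (Num.bound `|r|) => // k /= rk.
    by rewrite min_l// lee_fin le_natr_bound.
  under eq_fun do rewrite minye.
  apply/cvgeyPge => A; exists (Num.bound `|A|) => // k /= rk.
  by rewrite lee_fin le_natr_bound.
have := cvg_monotone_convergence measurableT mW W0 Wh.
rewrite (_ : (fun x => limn (W^~ x)) = (phi^\-)%E); last exact/funext.
move=> cW; rewrite integralE.
have -> : (\int[mu]_x phi^\+ x = (Int (tr phi 0))%:E)%E.
  rewrite -IntE//; apply: ae_eq_integral => //.
  - exact: measurable_funepos.
  - by apply/measurable_EFinP; exact: L1_measurable (Lt 0%N).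
  - by apply: filterS phiy => x px _; rewrite truncate_belowE// funeposE oppr0.
rewrite (_ : (fun k => _) = (fun k => (Int (tr phi 0))%:E - \int[mu]_x W k x)%E); last first.
  by apply/funext => k; rewrite IW oppeB// addeA subee// add0e.
by apply: cvgeB => //; exact: cvg_cst.
Qed.

Lemma integral_le_truncate_below phi k : measurable_fun setT phi -> dominated phi ->
  (\int[mu]_x phi x <= (Int (tr phi k))%:E)%E.
Proof.
move=> mphi dphi; have cI := cvg_Int_truncate_below mphi dphi.
rewrite -(cvg_lim _ cI)//; apply: lime_le; first by apply/cvg_ex; eexists; exact: cI.
exists k => // l /= kl; rewrite lee_fin; apply: le_Int; try exact: L1_truncate_below.
by apply: filterS (dominated_lty dphi) => x px; exact: truncate_below_le.
Qed.

Lemma le_integral_truncate_below phi (c : \bar R) :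
  measurable_fun setT phi -> dominated phi ->
  (forall k, c <= (Int (tr phi k))%:E)%E -> (c <= \int[mu]_x phi x)%E.
Proof.
move=> mphi dphi ck; have cI := cvg_Int_truncate_below mphi dphi.
rewrite -(cvg_lim _ cI)//; apply: lime_ge; first by apply/cvg_ex; eexists; exact: cI.
exact: nearW.
Qed.

End truncate_below.

Section markov_ext.
Context d (X : measurableType d) (R : realType) (mu : probability X R).
Variable P : (X -> R) -> X -> R.
Hypothesis PM : markov_operator mu P.

Local Notation L1 := (Lfun mu 1%E).
Local Notation Int f := (Rintegral mu setT f).
Local Notation tr := truncate_below.

Lemma measurable_markov_ext (phi : X -> \bar R) :
  measurable_fun setT phi -> dominated mu phi -> measurable_fun setT (markov_ext P phi).
Proof.
move=> mphi dphi; apply: measurable_fun_limn_esup => k.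
apply/measurable_EFinP; apply: (@L1_measurable _ _ _ mu).
by apply: (markov_L1 PM); exact: L1_truncate_below.
Qed.

Lemma markov_ext_le (phi : X -> \bar R) (u : X -> R) :
  measurable_fun setT phi -> u \in L1 -> (\forall x \ae mu, (phi x <= (u x)%:E)%E) ->
  \forall x \ae mu, (markov_ext P phi x <= (P u x)%:E)%E.
Proof.
move=> mphi Lu phiu; have dphi : dominated mu phi by exists u.
have Lt k := L1_truncate_below k mphi dphi.
pose U (k : nat) : X -> R := u \max cst (- k%:R).
have LU k : U k \in L1 by apply: L1_max => //; exact: L1_cst.
have PU : \forall x \ae mu, P (U k) x @[k --> \oo] --> P u x.
  apply: (markov_cvg_ni PM) => //.
    move=> k; apply: aeW => x; rewrite /U/= ge_max !le_max lexx/=.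
    by rewrite lerN2 ler_nat leqnSn orbT.
  apply: aeW => x; apply: cvg_near_cst; exists (Num.bound `|u x|) => // k /= uk.
  by rewrite /U /= max_l// ge_Nnatr_bound.
have PtU : \forall x \ae mu, forall k, P (tr phi k) x <= P (U k) x.
  apply: ae_foralln => k; apply: (markov_le PM (Lt k) (LU k)).
  apply: filterS phiu => x pu; rewrite /U/= -lee_fin truncate_belowE.
    by rewrite EFin_max ge_max !le_max pu lexx orbT.
  by case: (phi x) pu.
apply: filterS2 PU PtU => x PUx Ptx.
apply: (@le_limn_esup_cvg _ _ (fun k => (P (U k) x)%:E)).
  by move=> k; rewrite lee_fin.
by apply/cvg_EFin => //; exact: nearW.
Qed.

Lemma iter_markov_ext_le (phi : X -> \bar R) (u : X -> R) n :
  measurable_fun setT phi -> u \in L1 -> (\forall x \ae mu, (phi x <= (u x)%:E)%E) ->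
  measurable_fun setT (iter n (markov_ext P) phi) /\
  \forall x \ae mu, (iter n (markov_ext P) phi x <= (iter n P u x)%:E)%E.
Proof.
move=> mphi Lu phiu; elim: n => [//|n [mn nu]] /=.
have Lit := markov_L1 (markov_iter PM n) Lu.
split; last exact: markov_ext_le.
by apply: measurable_markov_ext => //; exists (iter n P u).
Qed.

Lemma markov_ext_invariant (g : X -> \bar R) : measurable_fun setT g ->
  dominated mu g -> (forall k, \forall x \ae mu, P (tr g k) x = tr g k x) ->
  markov_ext P g = g %[ae mu].
Proof.
move=> mg dg /ae_foralln Pg; apply: filterS2 Pg (dominated_lty dg) => x Pgx gy _.
rewrite /markov_ext; under eq_fun do rewrite Pgx truncate_belowE//.
exact: (cvg_limn_einf_sup (cvg_maxe_cst gy)).2.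
Qed.

Hypothesis P1 : P \1_[set: X] = \1_[set: X] %[ae mu].

(* [min (1, n (h - a)^+)] is invariant and increases to the indicator. *)
Lemma markov_superlevel (h : X -> R) (a : R) : h \in L1 ->
  (\forall x \ae mu, P h x = h x) ->
  P \1_[set x | a < h x] = \1_[set x | a < h x] %[ae mu].
Proof.
move=> Lh Ph; have LC c := L1_cst mu c.
set A := [set x | a < h x].
have mA : measurable A.
  by apply: (@measurable_lt_set _ _ _ (cst a)) => //; exact: L1_measurable Lh.
pose q : X -> R := (h - cst a) \max cst 0.
have Lha : h - cst a \in L1 by exact: L1B.
have Lq : q \in L1 by exact: L1_max.
have q0 x : 0 <= q x by rewrite /q/= le_max lexx orbT.
have Pq : \forall x \ae mu, q x = P q x.
  apply: (le_Int_ae_eq Lq (markov_L1 PM Lq)); last by rewrite (markov_Int PM).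
  have h1 : \forall x \ae mu, (h - cst a) x <= q x.
    by apply: aeW => x; rewrite /q/= le_max lexx.
  have h2 : \forall x \ae mu, 0 <= P q x by apply: (markov_ge0 PM) => //; exact: aeW.
  apply: filterS3 (filterI (markov_le PM Lha Lq h1) h2) (markovB PM Lh (LC a))
    (filterI Ph (markov_cst PM P1 a)) => x [e1 e2] e3 [e4 e5].
  rewrite {1}/q /= ge_max e2 andbT; apply: le_trans e1.
  by rewrite e3 e4 e5.
pose t (n : nat) : X -> R := (n%:R *: q) \min cst 1.
have Lnq n : n%:R *: q \in L1 by exact: L1Z.
have Lt n : t n \in L1 by exact: L1_min.
have Pt n : \forall x \ae mu, P (t n) x = t n x.
  apply: (le_Int_ae_eq (markov_L1 PM (Lt n)) (Lt n)); last by rewrite (markov_Int PM).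
  have h1 : \forall x \ae mu, t n x <= (n%:R *: q) x.
    by apply: aeW => x; rewrite /t/= ge_min lexx.
  have h2 : \forall x \ae mu, t n x <= (cst 1 : X -> R) x.
    by apply: aeW => x; rewrite /t/= ge_min lexx orbT.
  apply: filterS3 (filterI (markov_le PM (Lt n) (Lnq n) h1) (markov_le PM (Lt n) (LC 1) h2))
    (markovZ PM n%:R Lq) (filterI Pq (markov_cst PM P1 1)) => x [e1 e2] e3 [e4 e5].
  by rewrite {2}/t /= le_min -{2}e5 e2 andbT (le_trans e1)// e3 -e4.
have tA x : t n x @[n --> \oo] --> (\1_A x : R).
  rewrite indicE; have [Ax|Ax] := boolP (x \in A).
    have qx : 0 < q x.
      by rewrite /q/= lt_max; move/set_mem : Ax => /= Ax; rewrite !fctE subr_gt0 Ax.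
    apply: cvg_near_cst; exists (Num.bound (1 / q x)) => // n /= nq.
    rewrite /t/= min_r// -[(n%:R *: q) x]/(n%:R * q x) -ler_pdivrMr// ltW//.
    by rewrite (lt_le_trans (archi_boundP _)) ?ler_nat// divr_ge0.
  have qx : q x = 0.
    rewrite /q/= max_r// !fctE subr_le0 leNgt; apply: contra Ax => ax.
    by rewrite inE.
  apply: cvg_near_cst; apply: nearW => n.
  by rewrite /t/= !fctE qx scaler0 min_l.
have PtA : \forall x \ae mu, P (t n) x @[n --> \oo] --> P \1_A x.
  apply: (markov_cvg_nd PM) => //; first exact: L1_indic.
    move=> n; apply: aeW => x; rewrite /t/= le_min ge_min ge_min lexx !orbT andbT.
    by rewrite !fctE ler_wpM2r// ler_nat.
  exact: aeW.
apply: filterS2 PtA (ae_foralln Pt) => x PtAx Ptx _.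
have {}PtAx : t n x @[n --> \oo] --> P \1_A x.
  by rewrite (_ : t^~ x = (fun n => P (t n) x))//; apply/funext => n; rewrite Ptx.
exact: (cvg_unique _ PtAx (tA x)).
Qed.

End markov_ext.

(** * The subadditive ergodic theorem *)

Section subadditive.
Context d (X : measurableType d) (R : realType) (mu : probability X R).
Variables (P : (X -> R) -> X -> R) (phi : nat -> X -> \bar R).
Hypothesis PM : markov_operator mu P.
Hypothesis P1 : P \1_[set: X] = \1_[set: X] %[ae mu].
Hypothesis phi_meas : forall n, (0 < n)%N -> measurable_fun setT (phi n).
Hypothesis phi_subadd : subadditive_for mu P phi.
Hypothesis phi1_int : mu.-integrable [set: X] ((phi 1%N)^\+)%E.

Local Notation L1 := (Lfun mu 1%E).
Local Notation Int f := (Rintegral mu setT f).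
Local Notation tr := truncate_below.

Lemma subadditive_dominated n : (0 < n)%N -> dominated mu (phi n).
Proof.
have [Lu1 u1E] := integrable_fine_L1 phi1_int.
set u1 := fine \o _ in Lu1.
have phiu1 : \forall x \ae mu, (phi 1%N x <= (u1 x)%:E)%E.
  by apply: filterS u1E => x; rewrite /u1/= => <-; rewrite funeposE le_max lexx.
case: n => // n _; elim: n => [|n [u Lu phiu]]; first by exists u1.
have [_ phi1n] := iter_markov_ext_le PM n.+1 (phi_meas (ltn0Sn 0)) Lu1 phiu1.
exists (u + iter n.+1 P u1); first exact: (L1D Lu (markov_L1 (markov_iter PM n.+1) Lu1)).
have := phi_subadd (ltn0Sn n) (ltn0Sn 0); rewrite addn1.
by apply: filterS3 phiu phi1n => x h1 h2 /le_trans; apply; rewrite EFinD leeD.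
Qed.

Lemma L1_truncate_subadditive n k : (0 < n)%N -> tr (phi n) k \in L1.
Proof. by move=> n0; apply: L1_truncate_below; [exact: phi_meas|exact: subadditive_dominated]. Qed.

Lemma subadditive_lty : \forall x \ae mu, forall n, (0 < n)%N -> (phi n x != +oo)%E.
Proof.
apply: ae_foralln => n; have [n0|n0] := ltnP 0 n; last exact: aeW.
by apply: filterS (dominated_lty (subadditive_dominated n0)) => x.
Qed.

(* Adding [K n] turns [max (phi_n, - K n)] into a nonnegative subadditive
   sequence, whose limit is shifted by [K]. *)
Lemma truncated_kingman (K : nat) : exists h, [/\ h \in L1,
  \forall x \ae mu, P h x = h x,
  \forall x \ae mu, n.+1%:R^-1 * tr (phi n.+1) (K * n.+1) x @[n --> \oo] --> h x &
  n.+1%:R^-1 * Int (tr (phi n.+1) (K * n.+1)) @[n --> \oo] --> Int h /\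
  forall n, Int h <= n.+1%:R^-1 * Int (tr (phi n.+1) (K * n.+1))].
Proof.
pose f (n : nat) : X -> R :=
  if n is 0 then 0 else tr (phi n) (K * n) + cst (K * n)%:R.
have LC c := L1_cst mu c.
have Lt n : tr (phi n.+1) (K * n.+1) \in L1 by exact: L1_truncate_subadditive.
have Lf n : f n \in L1.
  by case: n => [|n]; [exact: (LC 0)|exact: L1D].
have f0 n : \forall x \ae mu, 0 <= f n x.
  case: n => [|n]; first exact: aeW.
  apply: filterS subadditive_lty => x /(_ n.+1 isT) px.
  by have := truncate_below_geN (K * n.+1) px; rewrite /f !fctE/=; lra.
have fS : markov_subadditive mu P f.
  move=> [|n] m; first by apply: aeW => x; rewrite /= add0r.
  case: m => [|m].
    apply: filterS (markov0 (markov_iter PM n.+1)) => x P0.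
    by rewrite addn0 [X in _ + X]P0 addr0.
  have phit : \forall x \ae mu, (phi m.+1 x <= (tr (phi m.+1) (K * m.+1) x)%:E)%E.
    by apply: filterS subadditive_lty => x /(_ m.+1 isT); exact: truncate_below_ge.
  have [_ hP] := iter_markov_ext_le PM n.+1 (phi_meas (ltn0Sn m)) (Lt m) phit.
  have QM := markov_iter PM n.+1.
  have hN : \forall x \ae mu, - (K * m.+1)%:R <= iter n.+1 P (tr (phi m.+1) (K * m.+1)) x.
    have h1 : \forall x \ae mu, (cst (- (K * m.+1)%:R) : X -> R) x <= tr (phi m.+1) (K * m.+1) x.
      by apply: filterS subadditive_lty => x /(_ m.+1 isT); exact: truncate_below_geN.
    by apply: filterS2 (markov_le QM (LC _) (Lt m) h1)
      (markov_cst QM (markov_iter1 PM P1 _) (- (K * m.+1)%:R)) => x + <-.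
  have hD := markovD QM (Lt m) (LC (K * m.+1)%:R).
  have hC := markov_cst QM (markov_iter1 PM P1 n.+1) (K * m.+1)%:R.
  apply: filterS3 (filterI (phi_subadd (ltn0Sn n) (ltn0Sn m)) subadditive_lty)
    (filterI hP hN) (filterI hD hC) => x [hs px] [hPx hNx] [hDx hCx].
  rewrite -[leLHS]/(tr (phi (n.+1 + m.+1)%N) (K * (n.+1 + m.+1)) x +
    (K * (n.+1 + m.+1))%:R).
  rewrite -[leRHS]/(tr (phi n.+1) (K * n.+1) x + (K * n.+1)%:R +
    iter n.+1 P (tr (phi m.+1) (K * m.+1) + cst (K * m.+1)%:R) x) hDx hCx.
  set p := iter n.+1 P _ x in hPx hNx *.
  have := truncate_below_geN (K * n.+1) (px n.+1 isT).
  have := truncate_below_ge (K * n.+1) (px n.+1 isT).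
  set r := tr (phi n.+1) (K * n.+1) x => hr1 hr2.
  have : tr (phi (n.+1 + m.+1)%N) (K * (n.+1 + m.+1)) x <= r + p.
    rewrite -lee_fin truncate_belowE ?px//.
    rewrite ge_max; apply/andP; split.
      by apply: (le_trans hs); rewrite EFinD leeD.
    by rewrite lee_fin mulnDr natrD; lra.
  by rewrite mulnDr natrD; lra.
have [g [Lg fg If Ige]] := kingman_nonneg PM P1 Lf erefl f0 fS.
have Pg := kingman_nonneg_invariant PM P1 Lf erefl f0 fS Lg fg.
have fE n x : n.+1%:R^-1 * f n.+1 x = n.+1%:R^-1 * tr (phi n.+1) (K * n.+1) x + K%:R.
  by rewrite /f !fctE /= mulrDr natrM mulrCA mulVf ?mulr1.
have IfE n : n.+1%:R^-1 * Int (f n.+1) =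
    n.+1%:R^-1 * Int (tr (phi n.+1) (K * n.+1)) + K%:R.
  by rewrite IntD// Int_cst mulrDr natrM mulrCA mulVf ?mulr1.
exists (g - cst K%:R); split.
- exact: L1B.
- by apply: filterS3 (markovB PM Lg (LC K%:R)) Pg (markov_cst PM P1 K%:R) => x -> -> ->.
- apply: filterS fg => x gx.
  rewrite (_ : (fun n => _) = fun n => n.+1%:R^-1 * f n.+1 x - K%:R).
    by apply: cvgB => //; exact: cvg_cst.
  by apply/funext => n; rewrite fE addrK.
rewrite IntB// Int_cst; split; last by move=> n; rewrite lerBlDr -IfE.
rewrite (_ : (fun n => _) = fun n => n.+1%:R^-1 * Int (f n.+1) - K%:R).
  by apply: cvgB => //; exact: cvg_cst.
by apply/funext => n; rewrite IfE addrK.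
Qed.

Lemma subadditive_ergodic : exists (g : X -> \bar R) (h : nat -> X -> R),
  [/\ measurable_fun setT g, dominated mu g,
    forall K, h K \in L1 /\ \forall x \ae mu, P (h K) x = h K x,
    \forall x \ae mu, forall K, tr g K x = h K x &
  [/\ \forall x \ae mu, ((n.+1%:R^-1)%:E * phi n.+1 x)%E @[n --> \oo] --> g x,
    forall K, n.+1%:R^-1 * Int (tr (phi n.+1) (K * n.+1)) @[n --> \oo] --> Int (h K) &
    forall K n, Int (h K) <= n.+1%:R^-1 * Int (tr (phi n.+1) (K * n.+1))]].
Proof.
have /choice[h hP] := truncated_kingman.
pose a n x := ((n.+1%:R^-1)%:E * phi n.+1 x)%E.
pose g x := limn_esup (a ^~ x).
have mg : measurable_fun setT g.
  apply: measurable_fun_limn_esup => n.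
  exact: (measurable_funeM (n.+1%:R^-1)%:E (phi_meas (ltn0Sn n))).
have main : \forall x \ae mu, [/\ (g x != +oo)%E, a n x @[n --> \oo] --> g x &
    forall K, maxe (g x) (- K%:R)%:E = (h K x)%:E].
  have hc : \forall x \ae mu, forall K,
      n.+1%:R^-1 * tr (phi n.+1) (K * n.+1) x @[n --> \oo] --> h K x.
    by apply: ae_foralln => K; have [_ _ hK _] := hP K; exact: hK.
  apply: filterS2 subadditive_lty hc => x px hx.
  have [|l [ly al lh]] := @cvg_of_truncations _ (a ^~ x) (h ^~ x).
    move=> K; rewrite (_ : (fun n => _) = (fun n => (n.+1%:R^-1 * tr (phi n.+1) (K * n.+1) x)%:E)).
      by apply/cvg_EFin; [exact: nearW|exact: hx].
    apply/funext => n; rewrite EFinM truncate_belowE ?px// maxe_pMr//.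
    by congr (maxe _ _); rewrite -EFinM natrM mulrN mulrCA mulVf ?mulr1.
  by rewrite /g (cvg_limn_einf_sup al).2.
have gh : \forall x \ae mu, forall K, tr g K x = h K x.
  apply: filterS main => x [gy _ gK] K.
  by apply: EFin_inj; rewrite truncate_belowE.
exists g, h; split=> //.
- exists (h 0%N); first by have [] := hP 0%N.
  by apply: filterS main => x [gy _ /(_ 0%N) <-]; rewrite le_max lexx.
- by move=> K; have [] := hP K.
split.
- by apply: filterS main => x [].
- by move=> K; have [_ _ _ []] := hP K.
- by move=> K; have [_ _ _ []] := hP K.
Qed.

End subadditive.

Theorem theorem4 (d : measure_display) (X : measurableType d) (R : realType)
    (mu : probability X R) (P : (X -> R) -> X -> R) (phi : nat -> X -> \bar R)
    (P_markov : markov_operator mu P)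
    (P_one : P \1_[set: X] = \1_[set: X] %[ae mu])
    (phi_meas : forall n, (0 < n)%N -> measurable_fun [set: X] (phi n))
    (phi_subadd : subadditive_for mu P phi)
    (phi1_int : mu.-integrable [set: X] ((phi 1%N)^\+)%E) :
  exists g : X -> \bar R,
    [/\ measurable_fun [set: X] g,
        markov_ext P g = g %[ae mu],
        mu.-integrable [set: X] (g^\+)%E &
        \forall x \ae mu, ((n%:R^-1)%:E * phi n x)%E @[n --> \oo] --> g x]
    /\ (mean_integral mu phi n @[n --> \oo] --> asymptotic_mean mu phi
        /\ (\int[mu]_x g x = asymptotic_mean mu phi)%E)
    /\ (ergodic_for mu P -> g = cst (asymptotic_mean mu phi) %[ae mu]).
Proof.
have [g [h [mg dg Ph gh [phig Ih hI]]]] :=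
  subadditive_ergodic P_markov P_one phi_meas phi_subadd phi1_int.
have Lh K : h K \in Lfun mu 1%E by have [] := Ph K.
have Lt n k : (0 < n)%N -> truncate_below (phi n) k \in Lfun mu 1%E.
  exact: (L1_truncate_subadditive P_markov phi_meas phi_subadd phi1_int).
have Ltg k : truncate_below g k \in Lfun mu 1%E by exact: L1_truncate_below.
have Igh K : Rintegral mu setT (truncate_below g K) = Rintegral mu setT (h K).
  by apply: Int_ae_eq => //; apply: filterS gh => x.
have gy := dominated_lty dg.
have Pg k : \forall x \ae mu, P (truncate_below g k) x = truncate_below g k x.
  have ghk : \forall x \ae mu, truncate_below g k x = h k x by apply: filterS gh.
  by apply: filterS3 ghk (markov_eq P_markov (Ltg k) (Lh k) ghk) (Ph k).2 => x -> -> ->.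
have mean : mean_integral mu phi n @[n --> \oo] --> (\int[mu]_x g x)%E.
  rewrite -cvg_shiftS; apply: limn_esup_le_cvg.
    apply: le_integral_truncate_below => // K; rewrite Igh.
    apply: (@le_limn_esup_cvg _ _ (fun n => (n.+1%:R^-1 *
        Rintegral mu setT (truncate_below (phi n.+1) (K * n.+1)))%:E)).
      move=> n; rewrite EFinM lee_wpmul2l ?lee_fin//.
      apply: integral_le_truncate_below; first exact: phi_meas.
      exact: (subadditive_dominated P_markov phi_meas phi_subadd phi1_int).
    by apply/cvg_EFin; [exact: nearW|exact: Ih].
  move=> n; rewrite /= /mean_integral.
  rewrite lee_pdivlMl//.
  have n0 : (0 < n.+1)%N by [].
  apply: le_integral_truncate_below; first exact: phi_meas.
    exact: (subadditive_dominated P_markov phi_meas phi_subadd phi1_int).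
  move=> k; apply: (@le_trans _ _ (n.+1%:R * Rintegral mu setT (h k))%:E).
    rewrite EFinM lee_wpmul2l ?lee_fin// -Igh.
    exact: integral_le_truncate_below.
  rewrite lee_fin -ler_pdivlMl//; apply: (le_trans (hI k n)).
  rewrite ler_wpM2l//; apply: le_Int; [exact: Lt|exact: Lt|].
  apply: filterS (subadditive_lty P_markov phi_meas phi_subadd phi1_int) => x px.
  by apply: truncate_below_le; [exact: px|rewrite leq_pmulr].
have LamE : asymptotic_mean mu phi = (\int[mu]_x g x)%E by exact: cvg_lim.
exists g; split; [split=> //|split; [by rewrite LamE|]].
- exact: markov_ext_invariant.
- have g0 : \forall x \ae mu, (g^\+ x)%E = (h 0%N x)%:E.
    by apply: filterS2 gy gh => x gx <-; rewrite truncate_belowE// funeposE oppr0.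
  have /Lfun1_integrable/integrableP[_ h0] := Lh 0%N.
  apply/integrableP; split; first exact: measurable_funepos.
  apply: le_lt_trans h0; apply: ae_ge0_le_integral => //.
  + by apply: measurableT_comp => //; exact: measurable_funepos.
  + apply: measurableT_comp => //; apply/measurable_EFinP.
    exact: (@L1_measurable _ _ _ mu).
  + by apply: filterS g0 => x ->.
- apply: filterS phig => x gx; rewrite -cvg_shiftS; exact: gx.
move=> erg; rewrite LamE.
have Int_lty : (\int[mu]_x g x < +oo)%E.
  by apply: le_lt_trans (integral_le_truncate_below 0 mg dg) _; rewrite ltry.
have level (a : R) :
    (\forall x \ae mu, (a%:E < g x)%E) \/ (\forall x \ae mu, (g x <= a%:E)%E).
  pose k := Num.bound `|a|.
  have ka : - k%:R <= a by exact: ge_Nnatr_bound.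
  have hg : \forall x \ae mu, (a < h k x) = (a%:E < g x)%E.
    apply: filterS2 gy gh => x gx <-; rewrite -lte_fin truncate_belowE// lt_max.
    by rewrite [X in _ || X]lte_fin [X in _ || X]ltNge ka orbF.
  have mA : measurable [set x | a < h k x].
    by apply: (@measurable_lt_set _ _ _ (cst a)) => //; exact: (@L1_measurable _ _ _ mu).
  have [A0|A1] := erg _ mA (markov_superlevel P_markov P_one a (Lh k) (Ph k).2).
    right; have : \forall x \ae mu, ~ [set x | a < h k x] x.
      by exists [set x | a < h k x]; split=> // x /= /contrapT.
    by apply: filterS2 hg => x /= ->; rewrite leNgt => /negP.
  left; have : \forall x \ae mu, [set x | a < h k x] x.
    exists (~` [set x | a < h k x]); split=> //; first exact: measurableC.
    by rewrite probability_setC// A1 subee.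
  by apply: filterS2 hg => x /= <-.
have above (a : R) : (\int[mu]_x g x < a%:E)%E -> \forall x \ae mu, (g x <= a%:E)%E.
  move=> Ia; have [ag|//] := level a; exfalso; move: Ia; apply/negP; rewrite -leNgt.
  apply: le_integral_truncate_below => // k; rewrite lee_fin -[leLHS](Int_cst mu).
  apply: le_Int => //; first exact: L1_cst.
  apply: filterS2 ag gy => x agx gx.
  by rewrite -lee_fin truncate_belowE// le_max ltW.
have below (a : R) : (a%:E < \int[mu]_x g x)%E -> \forall x \ae mu, (a%:E < g x)%E.
  move=> Ia; have [//|ga] := level a; exfalso; move: Ia; apply/negP; rewrite -leNgt.
  pose k := Num.bound `|a|.
  have ka : - k%:R <= a by exact: ge_Nnatr_bound.
  apply: le_trans (integral_le_truncate_below k mg dg) _.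
  rewrite lee_fin -[leRHS](Int_cst mu); apply: le_Int => //; first exact: L1_cst.
  apply: filterS2 ga gy => x gax gx.
  by rewrite -lee_fin truncate_belowE// ge_max gax lee_fin.
case: (\int[mu]_x g x)%E Int_lty above below => [r| |]// _ above below.
  have up : \forall x \ae mu, forall n, (g x <= (r + n.+1%:R^-1)%:E)%E.
    by apply: ae_foralln => n; apply: above; rewrite lte_fin ltrDl.
  have lo : \forall x \ae mu, forall n, ((r - n.+1%:R^-1)%:E < g x)%E.
    by apply: ae_foralln => n; apply: below; rewrite lte_fin gtrDl oppr_lt0.
  apply: filterS2 up lo => x upx lox _; apply/le_anti/andP; split.
    apply/lee_addgt0Pr => e e0.
    have [k _ /(_ k (leqnn k)) ke] := near_infty_natSinv_lt (PosNum e0).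
    by apply: le_trans (upx k) _; rewrite -EFinD lee_fin lerD2l ltW.
  apply/lee_addgt0Pr => e e0.
  have [k _ /(_ k (leqnn k)) ke] := near_infty_natSinv_lt (PosNum e0).
  rewrite -leeBlDr//; apply: le_trans (ltW (lox k)).
  by rewrite -EFinB lee_fin lerD2l lerN2 ltW.
have up : \forall x \ae mu, forall n, (g x <= (- n%:R)%:E)%E.
  by apply: ae_foralln => n; apply: above; rewrite ltNyr.
apply: filterS up => x gx _ /=; case: (g x) gx => [s| |]// gs.
  exfalso; have := gs (Num.bound `|s|); rewrite lee_fin lerNr leNgt => /negP; apply.
  by rewrite (le_lt_trans (ler_norm _))// normrN archi_boundP.
by have := gs 0%N.
Qed.
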